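(* Let $K\ge 0$ be a known integer and $\sigma^2>0$ be known, and let $Y\sim \mathsf{N}_n(\theta^\star,\sigma^2 I_n)$, where $\theta^\star$ has a piecewise degree-$K$ polynomial structure. Let $\pi^n$ be the marginal posterior distribution for the block configuration $B$ defined in the context, with prior constant $\lambda>0$. Then $$\mathsf{E}_{\theta^\star}\,\pi^n\big(\{B:\ B\sqsupset B_{\theta^\star}\text{ for some }B_{\theta^\star}\in\mathbb{B}^\star\}\big)\to 0,\qquad n\to\infty,$$ uniformly in $\theta^\star\in\Theta_n(K)\cap\{\theta:\ |B_\theta|=o(n^\lambda)\}$, where $\mathbb{B}^\star$ is the set of most economical block configurations of $\theta^\star$ and $B\sqsupset B'$ means that $B$ is a strict refinement of $B'$.
   Context: Piecewise polynomials: a simple partition (block configuration) $B$ of $\{1,\dots,n\}$ is a partition into nonempty blocks of consecutive indices $B(1),\dots,B(|B|)$; $|B|$ is the number of blocks. A vector $\theta\in\mathbb{R}^n$ has a piecewise degree-$K$ polynomial structure with respect to $B$ if, for each $s$, the sub-vector $(\theta_j)_{j\in B(s)}$ is given by a polynomial of degree at most $K$ in $j$. $B_\theta$ denotes a most economical (smallest number of blocks) such $B$; $|B_\theta|$ is its number of blocks. $B_\theta$ need not be unique; $\mathbb{B}^\star=\{B_{\theta^\star}\}$ denotes the set of all such equivalent block configurations of smallest size corresponding to $\theta^\star$. $B\sqsupset B'$ means that $B\ne B'$ and every block of $B'$ is a union of blocks of $B$. $\Theta_n(K)$ is the set of all $\theta\in\mathbb{R}^n$ with a piecewise degree-$K$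 polynomial structure and $|B_\theta|=o(n)$, i.e. $|B_\theta|\le b_n$ for a fixed sequence $b_n$ with $b_n/n\to0$. Similarly $|B_\theta|=o(n^\lambda)$ means $|B_\theta|\le c_n$ for a fixed sequence $c_n$ with $c_n/n^\lambda\to0$. Prior for $B$: $\pi_n(B)=\binom{n-1}{|B|-1}^{-1}f_n(|B|)$ over all simple partitions $B$ of $\{1,\dots,n\}$, where $f_n(b)\propto n^{-\lambda(b-1)}$, $b=1,\dots,n$, is a probability mass function and $\lambda>0$ is a constant. Marginal posterior for $B$: fix constants $v>0$, $\alpha\in(0,1)$. Let $Z\in\mathbb{R}^{n\times(K+1)}$ be a matrix whose columns form a basis of $\mathrm{span}\{v_0,\dots,v_K\}$, $v_k=(1^k,\dots,n^k)^\top$; let $Z_{B(s)}$ be its sub-matrix with row indices in $B(s)$, $P_{B(s)}$ the orthogonal projection onto the column space of $Z_{B(s)}$ (that is, $Z_{B(s)}\{Z_{B(s)}^\top Z_{B(s)}\}^{-1}Z_{B(s)}^\top$), and $Y_{B(s)}$ the sub-vector of $Y$ with indices in $B(s)$. Then $\pi^n$ is the probability distribution on simple partitions with $$\pi^n(B)\ \propto\ \pi_n(B)\Big(1+\frac{v\alpha}{\sigma^2}\Big)^{-(K+1)|B|/2}\exp\Big\{-\frac{\alpha}{2\sigma^2}\sum_{s=1}^{|B|}\|(I-P_{B(s)})Y_{B(s)}\|_2^2\Big\}.$$ $\mathsf{E}_{\theta^\star}$ is expectation over $Y\sim\mathsf{N}_n(\theta^\star,\sigma^2I_n)$. *)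

(* Defs.v *)
From HB Require Import structures.
From mathcomp Require Import all_boot all_order all_algebra.
From mathcomp Require Import all_classical all_reals all_analysis.
Set Implicit Arguments.
Unset Strict Implicit.
Unset Printing Implicit Defensive.
Import Order.TTheory GRing.Theory Num.Theory.
Local Open Scope ring_scope.

(** The index set {1, ..., n} is ['I_n], where [i : 'I_n] stands for the
    index [i.+1]. *)

Section BlockConfigurations.
Context {n : nat}.
Implicit Types (B : {set {set 'I_n}}) (C : {set 'I_n}).

Definition consecutive C : bool :=
  [forall i in C, forall k in C, forall j : 'I_n,
     (i <= j <= k)%N ==> (j \in C)].

Definition simple_partition B : bool :=
  finset.partition B [set: 'I_n] && [forall C in B, consecutive C].

(** $B \sqsupset B'$: [B] is the finer configuration. *)
Definition strict_refinement B B' : bool :=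
  (B != B') &&
  [forall C in B', exists S : {set {set 'I_n}},
     (S \subset B) && (C == finset.cover S)].

End BlockConfigurations.

Section PiecewisePolynomials.
Context {R : realType} (K : nat) {n : nat}.
Implicit Types (theta : 'cV[R]_n) (B : {set {set 'I_n}}).

Definition piecewise_poly theta B : Prop :=
  forall C, C \in B ->
  exists2 p : {poly R}, (size p <= K.+1)%N &
    forall j, j \in C -> theta j 0 = p.[j.+1%:R].

(** [B] is one of the most economical configurations of [theta], that is, an
    element of the set written $\mathbb{B}^\star$ when $\theta = \theta^\star$. *)
Definition most_economical theta B : Prop :=
  [/\ simple_partition B, piecewise_poly theta B &
      forall B', simple_partition B' -> piecewise_poly theta B' ->
        (#|B| <= #|B'|)%N].

(** $|B_\theta| \le r$; all most economical configurations of [theta] have the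
    same number of blocks, so it does not matter which one is taken. *)
Definition num_blocks_le theta (r : R) : Prop :=
  exists2 B, most_economical theta B & #|B|%:R <= r.

End PiecewisePolynomials.

Section Posterior.
Context {R : realType}.

(** The columns of [Z] form a basis of the span of the vectors
    $v_k = (1^k, \dots, n^k)^\top$, $k = 0, \dots, K$. *)
Definition poly_basis (K n : nat) (Z : 'M[R]_(n, K.+1)) : bool :=
  row_free Z^T &&
  (Z^T == (\matrix_(j < n, k < K.+1) (j.+1%:R ^+ k : R))^T)%MS.

(** The orthogonal projection onto the column space of [Z], acting on column
    vectors.  [proj_mx] and [kermx] follow the row-vector convention:
    the row space of [Z^T] is the column space of [Z], and [kermx Z] spans its
    orthogonal complement $\{u : u Z = 0\}$.  No rank condition on [Z] is
    needed, so blocks with fewer than [K.+1] indices are covered. *)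
Definition orthoproj (m p : nat) (Z : 'M[R]_(m, p)) : 'M[R]_m :=
  (proj_mx <<Z^T>>%MS (kermx Z))^T.

Lemma mulmx_tr_eq0 (m : nat) (u : 'rV[R]_m) : u *m u^T = 0 -> u = 0.
Proof.
move=> /matrixP /(_ 0 0); rewrite !mxE => /eqP.
rewrite psumr_eq0; last by move=> i _; rewrite mxE -expr2 sqr_ge0.
move=> /allP u0; apply/matrixP => i j; rewrite ord1 !mxE.
have /implyP/(_ isT) := u0 j (mem_index_enum j).
by rewrite mxE -expr2 sqrf_eq0 => /eqP.
Qed.

Lemma gram_unit (m p : nat) (Z : 'M[R]_(m, p)) :
  row_free Z^T -> Z^T *m Z \in unitmx.
Proof.
move=> Zfree; rewrite -row_free_unit -kermx_eq0; apply/eqP/row_matrixP => i.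
rewrite row0; set u := row i _.
have uG : u *m (Z^T *m Z) = 0 by apply/sub_kermxP; exact: row_sub.
have uZ : u *m Z^T = 0.
  by apply: mulmx_tr_eq0; rewrite trmx_mul trmxK mulmxA -(mulmxA u) uG mul0mx.
by apply: (row_free_inj Zfree); rewrite mul0mx.
Qed.

Lemma orthoprojE (m p : nat) (Z : 'M[R]_(m, p)) :
  row_free Z^T -> orthoproj Z = Z *m invmx (Z^T *m Z) *m Z^T.
Proof.
move=> Zfree; have GU := gram_unit Zfree.
set Q := RHS.
have QT : Q^T = Q.
  by rewrite /Q !trmx_mul trmxK trmx_inv trmx_mul trmxK mulmxA.
rewrite /orthoproj -QT; congr trmx.
have cap0 : (<<Z^T>> :&: kermx Z)%MS = 0.
  apply/eqP; rewrite -submx0; apply/rV_subP => u.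
  rewrite sub_capmx genmxE => /andP[/submxP[w ->]] /sub_kermxP.
  rewrite -mulmxA => wG; rewrite submx0; apply/eqP.
  by apply: mulmx_tr_eq0; rewrite trmx_mul trmxK mulmxA -(mulmxA w) wG mul0mx.
rewrite -[LHS]mul1mx -[1%:M in LHS](subrK Q) mulmxDl.
rewrite proj_mx_0 //; last first.
  by apply/sub_kermxP; rewrite mulmxBl mul1mx /Q -!mulmxA mulVmx// mulmx1 subrr.
by rewrite add0r proj_mx_id // genmxE submxMl.
Qed.

Definition sqnorm (m : nat) (u : 'cV[R]_m) : R := \sum_i u i 0 ^+ 2.

Definition block_rows (n p : nat) (C : {set 'I_n}) (A : 'M[R]_(n, p)) :
    'M[R]_(#|C|, p) :=
  rowsub (fun k : 'I_#|C| => enum_val k) A.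

Definition rss (n p : nat) (Z : 'M[R]_(n, p)) (Y : 'cV[R]_n)
    (B : {set {set 'I_n}}) : R :=
  \sum_(C in B)
    sqnorm ((1%:M - orthoproj (block_rows C Z)) *m block_rows C Y).

(** The probability mass function $f_n(b) \propto n^{-\lambda(b-1)}$,
    $b = 1, \dots, n$. *)
Definition block_count_pmf (lambda : R) (n b : nat) : R :=
  n%:R `^ (- lambda * b.-1%:R) /
  \sum_(1 <= a < n.+1) n%:R `^ (- lambda * a.-1%:R).

Definition prior (lambda : R) (n : nat) (B : {set {set 'I_n}}) : R :=
  'C(n.-1, #|B|.-1)%:R^-1 * block_count_pmf lambda n #|B|.

Section MarginalPosterior.
Context (K : nat) (sigma lambda v alpha : R) {n : nat}.
Context (Z : 'M[R]_(n, K.+1)) (Y : 'cV[R]_n).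

Definition posterior_weight (B : {set {set 'I_n}}) : R :=
  prior lambda B
  * (1 + v * alpha / sigma ^+ 2) `^ (- (K.+1 * #|B|)%:R / 2)
  * expR (- (alpha / (2 * sigma ^+ 2)) * rss Z Y B).

(** $\pi^n(\{B : E(B)\})$. *)
Definition posterior (E : {set {set 'I_n}} -> Prop) : R :=
  (\sum_(B | simple_partition B && `[< E B >]) posterior_weight B) /
  \sum_(B | simple_partition B) posterior_weight B.

End MarginalPosterior.

End Posterior.

Section GaussianVector.
Context {R : realType}.

Definition tcons (n : nat) (xy : measurableTypeR R * n.-tuple R) : n.+1.-tuple R :=
  [tuple of xy.1 :: xy.2].

Lemma measurable_tcons n : measurable_fun [set: measurableTypeR R * n.-tuple R] (@tcons n).
Proof. exact: measurable_cons. Qed.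

HB.instance Definition _ n :=
  isMeasurableFun.Build _ _ _ _ (@tcons n) (@measurable_tcons n).

(** $\mathsf{N}_n(\theta, \sigma^2 I_n)$ as the product of the laws
    $\mathsf{N}(\theta_i, \sigma^2)$; the second parameter of [normal_prob] is
    the standard deviation. *)
Fixpoint gaussian (sigma : R) (n : nat) :
    'cV[R]_n -> probability (n.-tuple R) R :=
  match n with
  | 0 => fun _ => \d_([tuple])
  | n'.+1 => fun theta =>
      distribution (normal_prob (theta ord0 0%R) sigma
                    \x @gaussian sigma n' (row' ord0 theta))%E
                   (@tcons n')
  end.

Lemma gaussian_box (sigma : R) (n : nat) (theta : 'cV[R]_n)
    (A : 'I_n -> set (measurableTypeR R)) :
  (forall i, measurable (A i)) ->
  gaussian sigma theta [set y | forall i, A i (tnth y i)]%classic =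
  (\prod_(i < n) normal_prob (theta i ord0) sigma (A i))%E.
Proof.
elim: n theta A => [|n IH] theta A mA.
  by rewrite big_ord0 /= diracE mem_set// => -[].
rewrite big_ord_recl /= /distribution /pushforward.
have -> : (@tcons n @^-1` [set y | forall i, A i (tnth y i)] =
  A ord0 `*` [set y | forall i, A (lift ord0 i) (tnth y i)])%classic.
  apply/seteqP; split=> [[x y] /= H|[x y] /= [H0 H] i].
    by split=> [|i]; [exact: H ord0|have := H (lift ord0 i); rewrite tnthS].
  by case: (unliftP ord0 i) => [j|] ->; [rewrite tnthS|].
rewrite product_measure1E//; last first.
  rewrite (_ : [set y | _]%classic = (\bigcap_(i in [set: 'I_n]) ((@tnth n R)^~ i @^-1` A (lift ord0 i)))%classic); last first.
    by apply/seteqP; split => y /= H i => [_|]; [exact: H|exact: (H i Logic.I)].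
  apply: fin_bigcap_measurable => // i _.
  have := @measurable_tnth _ (measurableTypeR R) n i measurableT _ (mA (lift ord0 i)).
  by rewrite setTI.
congr (_ * _)%E.
rewrite [LHS](IH (row' ord0 theta) (fun i => A (lift ord0 i))) //.
by apply: eq_bigr => i _;  rewrite mxE.
Qed.

End GaussianVector.

(* Main.v *)
(** A strict refinement [B] of a most economical configuration [B0] differs from
    it by a pair [(D, E)]: the blocks [D] of [B0] which are broken up, and the
    blocks [E] of [B] which replace them, with [m >= 1] new cuts.  The ratio of
    the posterior weights of [B] and [B0] depends on [(D, E)] and [#|B0|] only,
    and [B0] with [(D, E)] determines [B].  Summing first over the refinements
    of each [B0] and then over all [B0], whose total mass is at most [1], bounds
    the posterior probability by the sum of these ratios over all pairs
    [(D, E)], whatever the number of most economical configurations.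

    The difference of the residual sums of squares over [D] and over [E] is a
    squared projection of the noise of rank at most [(K + 1) m], so the
    expected ratio is at most [C ^ m n ^ (- lambda m)] times the ratio of the
    binomial coefficients of the prior.

    A pair is determined by its [m] new cuts and by [D], every block of which
    contains one of these cuts.  By an exchange argument two most economical
    configurations number their cuts in almost the same way, and cuts with the
    same number are at most [K] apart.  Hence at most [2 (K + 1) ^ 2] blocks of
    most economical configurations contain a given index, and there are at most
    [C ^ m] choices for [D].  The expected posterior probability is thus bounded
    by the sum over [m >= 1] of [(C #|B0| / n ^ lambda) ^ m]. *)

Require Import Defs.
From mathcomp Require Import all_boot all_order all_algebra.
From mathcomp Require Import all_classical all_reals all_analysis.
From mathcomp Require Import measurable_realfun zify ring lra.
Import Order.TTheory GRing.Theory Num.Theory.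
Import numFieldNormedType.Exports.
Local Open Scope ring_scope.
Set Implicit Arguments.
Unset Strict Implicit.
Unset Printing Implicit Defensive.

(** * Gaussian integrals *)

Section GaussianIntegrals.
Local Open Scope classical_set_scope.
Context {R : realType}.
Local Notation mu := (@lebesgue_measure R).

Import HBNNSimple.

Let integral_normal_nnsfun (m s : R) (f : {nnsfun measurableTypeR R >-> R}) :
  (\int[normal_prob m s]_x (f x)%:E =
   \int[mu]_x ((f x)%:E * (normal_pdf m s x)%:E))%E.
Proof.
under [LHS]eq_integral do rewrite fimfunE -fsumEFin//.
rewrite [LHS]ge0_integral_fsum//; last 2 first.
  - by move=> r; exact/measurable_EFinP/measurableT_comp.
  - by move=> n x _; rewrite EFinM nnfun_muleindic_ge0.
have mpdf : measurable_fun [set: R] (fun x => (normal_pdf m s x)%:E).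
  by apply/measurable_EFinP; exact: measurable_normal_pdf.
have pdf0 x : (0 <= (normal_pdf m s x)%:E)%E by rewrite lee_fin normal_pdf_ge0.
under [RHS]eq_integral => x _.
  rewrite fimfunE -fsumEFin// ge0_mule_fsuml; last first.
    by move=> r; rewrite EFinM nnfun_muleindic_ge0.
  over.
rewrite [RHS]ge0_integral_fsum//; last 2 first.
  - move=> r; apply: emeasurable_funM => //.
    exact/measurable_EFinP/measurableT_comp.
  - by move=> n x _; rewrite mule_ge0//; rewrite EFinM nnfun_muleindic_ge0.
apply: eq_fsbigr => r /set_mem rf.
have r0 : 0 <= r by case: rf => x _ <-.
under [RHS]eq_integral do rewrite EFinM -muleA.
rewrite [RHS]ge0_integralZl//; last 2 first.
  - by apply: emeasurable_funM => //; apply/measurable_EFinP.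
  - by move=> x _; rewrite mule_ge0// lee_fin.
rewrite integralZl_indic_nnsfun//; congr (_ * _)%E.
rewrite integral_indic// setIT /normal_prob [LHS]integral_mkcond.
apply: eq_integral => x _; rewrite /patch indicE; case: ifPn => xA.
  by rewrite mul1e.
by rewrite mul0e.
Qed.

(** [normal_prob] has density [normal_pdf]: first for simple functions, then in general by monotone
    convergence. *)
Lemma integral_normal_prob (m s : R) (f : measurableTypeR R -> \bar R) :
  measurable_fun setT f -> (forall x, 0 <= f x)%E ->
  (\int[normal_prob m s]_x f x = \int[mu]_x (f x * (normal_pdf m s x)%:E))%E.
Proof.
move=> mf f0.
have mpdf : measurable_fun [set: R] (fun x => (normal_pdf m s x)%:E).
  by apply/measurable_EFinP; exact: measurable_normal_pdf.
have pdf0 x : (0 <= (normal_pdf m s x)%:E)%E by rewrite lee_fin normal_pdf_ge0.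
pose f_ := nnsfun_approx measurableT mf.
transitivity (lim (\int[normal_prob m s]_x (f_ n x)%:E @[n --> \oo])%E).
  rewrite -monotone_convergence//=.
  - apply: eq_integral => ? /[!inE] xD; apply/esym/cvg_lim => //=.
    exact: cvg_nnsfun_approx.
  - by move=> n; exact/measurable_EFinP/measurable_funTS.
  - by move=> n ? _; rewrite lee_fin.
  - by move=> ? _ ? ? mn; rewrite lee_fin; exact/lefP/nd_nnsfun_approx.
under eq_fun do rewrite integral_normal_nnsfun.
rewrite -monotone_convergence//=.
- apply: eq_integral => x /[!inE] xD; apply/cvg_lim => //=.
  by apply: cvgeZr => //; exact: cvg_nnsfun_approx.
- move=> n; apply: emeasurable_funM => //.
  by exact/measurable_EFinP/measurable_funTS.
- by move=> n x _; rewrite mule_ge0// lee_fin.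
- move=> x _ a b ab; rewrite lee_wpmul2r// lee_fin.
  exact/lefP/nd_nnsfun_approx.
Qed.

Lemma integral_scaled_normal_pdf (c m s : R) : 0 <= c ->
  (\int[mu]_x (c%:E * (normal_pdf m s x)%:E) = c%:E)%E.
Proof.
move=> c0; rewrite (ge0_integralZl _ measurableT).
- by rewrite integral_normal_pdf mule1.
- by apply/measurable_EFinP; exact: measurable_normal_pdf.
- by move=> x _; rewrite lee_fin normal_pdf_ge0.
- by rewrite lee_fin.
Qed.

(** Completing the square turns the integrand times the density into a constant times the normal
    density with mean [m + s ^+ 2 * h]. *)
Lemma normal_mgf (m s h : R) : 0 < s ->
  (\int[normal_prob m s]_x (expR (h * (x - m)))%:E =
   (expR (h ^+ 2 * s ^+ 2 / 2))%:E)%E.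
Proof.
move=> s0; rewrite integral_normal_prob; last 2 first.
- apply/measurable_EFinP/measurableT_comp => //; apply: measurable_funM => //.
  exact: measurable_funB.
- by move=> x; rewrite lee_fin expR_ge0.
rewrite -[RHS](integral_scaled_normal_pdf (m + s ^+ 2 * h) s (expR_ge0 _)).
apply: eq_integral => x _; rewrite -!EFinM; congr EFin.
rewrite !normal_pdfE ?gt_eqF// mulrCA [RHS]mulrCA; congr (_ * _).
rewrite /normal_fun -!expRD; congr expR; field.
by rewrite gt_eqF.
Qed.

Lemma normal_peakE (s : R) : 0 < s ->
  normal_peak s = s^-1 * (Num.sqrt (pi *+ 2))^-1.
Proof.
move=> s0; rewrite /normal_peak -mulrnAr sqrtrM ?sqr_ge0// sqrtr_sqr.
by rewrite gtr0_norm// invfM.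
Qed.

(** The integrand times the standard density is [t] times the centred normal density with standard
    deviation [t]. *)
Lemma normal_sqr_mgf (a : R) : a < 1 ->
  (\int[normal_prob 0 1]_x (expR (a / 2 * x ^+ 2))%:E =
   ((Num.sqrt (1 - a))^-1)%:E)%E.
Proof.
move=> a1; have a0 : 0 < 1 - a by rewrite subr_gt0.
set t := (Num.sqrt (1 - a))^-1.
have t0 : 0 < t by rewrite invr_gt0 sqrtr_gt0.
have t2 : t ^+ 2 = (1 - a)^-1 by rewrite exprVn sqr_sqrtr// ltW.
rewrite integral_normal_prob; last 2 first.
- by apply/measurable_EFinP/measurableT_comp => //; apply: measurable_funM.
- by move=> x; rewrite lee_fin expR_ge0.
rewrite -[RHS](integral_scaled_normal_pdf 0 t (ltW t0)).
apply: eq_integral => x _; rewrite -!EFinM; congr EFin.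
rewrite !normal_pdfE ?gt_eqF// mulrCA [RHS]mulrA; congr (_ * _).
  by rewrite !normal_peakE// invr1 mul1r mulVKf// gt_eqF.
rewrite /normal_fun -!expRD; congr expR.
rewrite t2 !subr0 expr1n; field.
by rewrite gt_eqF.
Qed.

End GaussianIntegrals.

(** * Exponential moments of Gaussian vectors *)

Section GaussianVectorIntegrals.
Local Open Scope classical_set_scope.
Context {R : realType}.

Lemma measurable_prod_tnth (n : nat) (f : 'I_n -> measurableTypeR R -> R) :
  (forall i, measurable_fun setT (f i)) ->
  measurable_fun [set: n.-tuple R] (fun y => \prod_i f i (tnth y i)).
Proof.
move=> mf; apply: measurable_prod => i _.
apply: (measurableT_comp (mf i)); exact: measurable_tnth.
Qed.

(** Induction on the dimension: [gaussian] adds one coordinate at a time, and Tonelli's theorem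
    splits off the first factor. *)
Lemma gaussian_integral_prod (s : R) (n : nat) (theta : 'cV[R]_n)
    (f : 'I_n -> measurableTypeR R -> R) (c : 'I_n -> R) :
  (forall i, measurable_fun setT (f i)) -> (forall i x, 0 <= f i x) ->
  (forall i, \int[normal_prob (theta i 0%R) s]_x (f i x)%:E = (c i)%:E)%E ->
  (\int[gaussian s theta]_y (\prod_i f i (tnth y i))%:E = (\prod_i c i)%:E)%E.
Proof.
elim: n theta f c => [|n IH] theta f c mf f0 fc.
  rewrite big_ord0 /= integral_dirac//; last first.
    by apply/measurable_EFinP; exact: measurable_prod_tnth.
  by rewrite diracT mul1e big_ord0.
rewrite /= ge0_integral_distribution; last 2 first.
- by apply/measurable_EFinP; exact: measurable_prod_tnth.
- by move=> y; rewrite lee_fin prodr_ge0.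
pose g (y : n.-tuple R) := \prod_i f (lift ord0 i) (tnth y i).
have g0 y : 0 <= g y by rewrite prodr_ge0.
have mg : measurable_fun setT g.
  by apply: (measurable_prod_tnth (f := fun i => f (lift ord0 i))).
have -> : ((fun y => (\prod_i f i (tnth y i))%:E) \o @tcons R n =
           (fun z => (f ord0 z.1)%:E * (g z.2)%:E))%E.
  apply/funext => -[x y] /=; rewrite big_ord_recl EFinM; congr (_ * _%:E)%E.
  by apply: eq_bigr => i _; rewrite tnthS.
rewrite fubini_tonelli1; last 2 first.
- apply: emeasurable_funM; apply/measurable_EFinP.
    by apply: (measurableT_comp (mf ord0)).
  by apply: (measurableT_comp mg).
- by move=> z; rewrite mule_ge0// lee_fin.
rewrite /fubini_F /=.
under eq_integral => x _.
  rewrite ge0_integralZl//; last 3 first.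
  - exact/measurable_EFinP.
  - by move=> y _; rewrite lee_fin.
  - by rewrite lee_fin.
  rewrite (IH _ (fun i => f (lift ord0 i)) (fun i => c (lift ord0 i)))//; last first.
    by move=> i; rewrite mxE fc.
  over.
rewrite ge0_integralZr//; last 3 first.
- exact/measurable_EFinP.
- by move=> y _; rewrite lee_fin.
- rewrite lee_fin prodr_ge0// => i _.
  by rewrite -lee_fin -fc integral_ge0// => x _; rewrite lee_fin.
by rewrite [X in (X * _)%E](fc ord0) big_ord_recl EFinM.
Qed.

Lemma gaussian_mgf (s : R) (n : nat) (theta : 'cV[R]_n) (h : 'I_n -> R) :
  0 < s ->
  (\int[gaussian s theta]_y
     (expR (\sum_i h i * (tnth y i - theta i 0%R)))%:E =
   (expR (s ^+ 2 / 2 * \sum_i h i ^+ 2))%:E)%E.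
Proof.
move=> s0; under eq_integral do rewrite expR_sum.
rewrite (gaussian_integral_prod
  (f := fun i x => expR (h i * (x - theta i 0)))
  (c := fun i => expR (h i ^+ 2 * s ^+ 2 / 2))).
- by rewrite -expR_sum mulr_sumr; congr (expR _)%:E; apply: eq_bigr => i _; ring.
- move=> i; apply: measurableT_comp => //; apply: measurable_funM => //.
  exact: measurable_funB.
- by move=> i x; exact: expR_ge0.
- by move=> i; rewrite normal_mgf.
Qed.

Lemma gaussian_sqr_mgf (n : nat) (a : R) : a < 1 ->
  (\int[gaussian 1%R (0%R : 'cV[R]_n)]_y
     (expR (a / 2 * \sum_i tnth y i ^+ 2))%:E =
   ((Num.sqrt (1 - a))^-1 ^+ n)%:E)%E.
Proof.
move=> a1; under eq_integral do rewrite mulr_sumr expR_sum.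
rewrite (gaussian_integral_prod
  (f := fun i x => expR (a / 2 * x ^+ 2))
  (c := fun i => (Num.sqrt (1 - a))^-1)).
- by rewrite prodr_const card_ord.
- by move=> i; apply: measurableT_comp => //; apply: measurable_funM.
- by move=> i x; exact: expR_ge0.
- by move=> i; rewrite mxE normal_sqr_mgf.
Qed.

End GaussianVectorIntegrals.

(** * Exponential moment of a squared projection of Gaussian noise *)

Section OrthonormalChaos.
Local Open Scope classical_set_scope.
Context {R : realType}.

(** The square is linearised by an auxiliary standard Gaussian vector [g] of dimension [d]: the
    integrand is the integral over [g] of the exponential of a form bilinear in [g] and the noise.
    Once the integrals are exchanged, the one over [y] yields [expR (a / 2 * |g|^2)] because [U] has
    orthonormal rows. *)
Lemma gaussian_orthonormal_mgf (s a : R) (d n : nat) (U : 'M[R]_(d, n))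
    (theta : 'cV[R]_n) :
  0 < s -> 0 <= a < 1 -> U *m U^T = 1%:M ->
  (\int[gaussian s theta]_y
     (expR (a / (2 * s ^+ 2) * sqnorm (U *m (\col_i tnth y i - theta))))%:E =
   ((Num.sqrt (1 - a))^-1 ^+ d)%:E)%E.
Proof.
move=> s0 /andP[a0 a1] UU.
(* With this [k] the integral over [g] restores the coefficient [a / (2 * s ^+ 2)]. *)
pose k := Num.sqrt a / s.
pose B (y : n.-tuple R) (g : d.-tuple R) :=
  \sum_j \sum_i (k * U j i * (tnth y i - theta i 0) * tnth g j).
have mB : measurable_fun [set: n.-tuple R * d.-tuple R] (fun z => B z.1 z.2).
  apply: measurable_sum => j; apply: measurable_sum => i.
  apply: measurable_funM; last first.
    apply: (measurableT_comp (measurable_tnth j)); exact: measurable_snd.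
  apply: measurable_funM => //; apply: measurable_funB => //.
  apply: (measurableT_comp (measurable_tnth i)); exact: measurable_fst.
have BUg y g : B y g =
    \sum_j (k * (U *m (\col_i tnth y i - theta)) j 0) * (tnth g j - (0 : 'cV_d) j 0).
  apply: eq_bigr => j _; rewrite !mxE subr0 mulr_sumr mulr_suml.
  by apply: eq_bigr => i _; rewrite !mxE mulrA.
have BUy y g : B y g =
    \sum_i (k * (U^T *m (\col_j tnth g j)) i 0) * (tnth y i - theta i 0).
  rewrite /B exchange_big; apply: eq_bigr => i _; rewrite !mxE mulr_sumr mulr_suml.
  by apply: eq_bigr => j _; rewrite !mxE; ring.
have k2 : k ^+ 2 = a / s ^+ 2 by rewrite exprMn sqr_sqrtr// exprVn.
have s2 : s != 0 by rewrite gt_eqF.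
transitivity (\int[gaussian s theta]_y \int[gaussian 1%R (0%R : 'cV[R]_d)]_g
    (expR (B y g))%:E)%E.
  apply: eq_integral => y _.
  under [RHS]eq_integral do rewrite BUg.
  rewrite gaussian_mgf// expr1n; congr (expR _)%:E.
  rewrite /sqnorm !mulr_sumr; apply: eq_bigr => j _.
  rewrite exprMn k2; field.
  by rewrite s2.
have mE : measurable_fun setT (fun z => (expR (B z.1 z.2))%:E).
  by apply/measurable_EFinP/measurableT_comp.
rewrite [LHS](fubini_tonelli _ mE); last by move=> z; rewrite lee_fin expR_ge0.
rewrite -(gaussian_sqr_mgf d a1).
apply: eq_integral => g _ /=.
under eq_integral do rewrite BUy.
rewrite gaussian_mgf//; congr (expR _)%:E.
have sqnormE p (u : 'cV[R]_p) : \sum_i u i 0 ^+ 2 = (u^T *m u) 0 0.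
  by rewrite !mxE; apply: eq_bigr => i _; rewrite !mxE expr2.
rewrite (eq_bigr (fun i => k ^+ 2 * (U^T *m (\col_j tnth g j)) i 0 ^+ 2));
  last by move=> i _; rewrite exprMn.
rewrite k2 -mulr_sumr sqnormE trmx_mul trmxK mulmxA -(mulmxA _ U) UU mulmx1 -sqnormE.
set S := (X in _ * (_ * X)).
have -> : \sum_i tnth g i ^+ 2 = S by apply: eq_bigr => i _; rewrite mxE.
by field.
Qed.

End OrthonormalChaos.

(** * Projections onto blocks *)

Section Projections.
Context {R : realType}.

(** Rows of an idempotent [G] are fixed by [G]. A nonzero one is normalised to [v] and split off;
    [G - v^T *m v] is again symmetric and idempotent, and induction on the rank applies. *)
Lemma orthonormal_factor (n : nat) (G : 'M[R]_n) :
  G^T = G -> G *m G = G ->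
  exists d, (d <= \rank G)%N /\
    exists U : 'M[R]_(d, n), U *m U^T = 1%:M /\ U^T *m U = G.
Proof.
have [r] := ubnP (\rank G); elim: r G => // r IH G rG GT GG.
have [->|] := eqVneq G 0.
  exists 0; split=> //; exists 0; split; last by rewrite mulmx0.
  by apply/matrixP => -[].
move=> /eqP G0; have [u [uG u0]] : exists u : 'rV_n, u *m G = u /\ u != 0.
  have [i ui|all0] := pickP (fun i => row i G != 0).
    by exists (row i G); rewrite -row_mul GG.
  case: G0; apply/row_matrixP => i; rewrite row0; apply/eqP.
  by have /negbFE := all0 i.
pose q := \sum_j u 0 j ^+ 2.
have uu : u *m u^T = q%:M.
  rewrite [LHS]mx11_scalar mxE; congr _%:M.
  by apply: eq_bigr => j _; rewrite mxE expr2.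
have q0 : 0 < q.
  rewrite lt_neqAle sumr_ge0 ?andbT; last by move=> j _; exact: sqr_ge0.
  apply: contraNneq u0 => q0; apply/eqP/mulmx_tr_eq0.
  by rewrite uu -q0 raddf0.
pose v := (Num.sqrt q)^-1 *: u.
have vv : v *m v^T = 1%:M.
  rewrite /v linearZ/= -scalemxAl -scalemxAr uu scalerA -invfM -expr2.
  by rewrite sqr_sqrtr ?ltW// scale_scalar_mx mulVf ?gt_eqF.
have vG : v *m G = v by rewrite /v -scalemxAl uG.
have GvT : G *m v^T = v^T by rewrite -{1}GT -trmx_mul vG.
pose G' := G - v^T *m v.
have G'T : G'^T = G' by rewrite /G' linearB/= trmx_mul trmxK GT.
have vG' : v *m G' = 0 by rewrite mulmxBr vG mulmxA vv mul1mx subrr.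
have G'v : G' *m v^T = 0 by rewrite -G'T -trmx_mul vG' trmx0.
have G'G' : G' *m G' = G'.
  rewrite {2}/G' mulmxBr mulmxA G'v mul0mx subr0 mulmxBl GG.
  by rewrite -mulmxA vG.
(* [v] lies in the row space of [G] but is orthogonal to that of [G'], so the rank drops. *)
have G'ltG : (G' < G)%MS.
  rewrite ltmxE; apply/andP; split.
    have -> : G' = G' *m G by rewrite mulmxBl GG -mulmxA vG.
    exact: submxMl.
  apply/negP => /submxP[W GW].
  have : v *m v^T = 0.
    rewrite -[in X in X *m _]vG GW -mulmxA -mulmxA.
    by rewrite G'v !mulmx0.
  rewrite vv => /matrixP/(_ 0 0); rewrite !mxE/= => /eqP.
  by rewrite oner_eq0.
have rG' : (\rank G' < \rank G)%N by apply: rank_ltmx.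
have [d [dG' [U [UU UTU]]]] := IH G' (leq_trans rG' rG) G'T G'G'.
exists (1 + d)%N; split; first by rewrite add1n (leq_ltn_trans dG').
have vU : v *m U^T = 0.
  by apply: mulmx_tr_eq0; rewrite trmx_mul trmxK mulmxA -(mulmxA v) UTU vG' mul0mx.
have Uv : U *m v^T = 0 by rewrite -[U]trmxK -trmx_mul vU trmx0.
exists (col_mx v U); split.
  by rewrite tr_col_mx mul_col_row vv UU vU Uv -scalar_mx_block.
by rewrite tr_col_mx mul_row_col UTU addrC subrK.
Qed.

(** The row space of [A^T] and the kernel of [A] are complementary, since a vector in both has norm
    zero. So [Q] fixes [A] and factors as [W *m A^T]; these give [Q *m Q^T = Q^T], which makes [Q]
    symmetric. *)
Lemma orthoproj_props (m p : nat) (A : 'M[R]_(m, p)) :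
  [/\ (orthoproj A)^T = orthoproj A, orthoproj A *m orthoproj A = orthoproj A,
      orthoproj A *m A = A & exists W, orthoproj A = A *m W].
Proof.
pose Q := proj_mx <<A^T>>%MS (kermx A).
have cap0 : (<<A^T>> :&: kermx A)%MS = 0.
  apply/eqP; rewrite -submx0; apply/rV_subP => u.
  rewrite sub_capmx genmxE => /andP[/submxP[w ->]] /sub_kermxP wA.
  rewrite submx0; apply/eqP; apply: mulmx_tr_eq0.
  by rewrite trmx_mul trmxK mulmxA wA mul0mx.
have full : row_full (<<A^T>> + kermx A)%MS.
  rewrite -col_leq_rank mxrank_disjoint_sum// genmxE mxrank_tr mxrank_ker.
  by rewrite subnKC// rank_leq_row.
have [W QW] : exists W, Q = W *m A^T.
  by apply/submxP; rewrite -(genmxE A^T) -[X in (X <= _)%MS]mul1mx proj_mx_sub.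
have QA : Q *m A = A.
  apply/eqP; rewrite -subr_eq0 -opprB oppr_eq0 -[X in X - _]mul1mx -mulmxBl.
  apply/eqP/sub_kermxP; rewrite -[Q]mul1mx.
  by rewrite proj_mx_compl_sub// submx_full.
have QQ : Q *m Q^T = Q^T by rewrite QW trmx_mul trmxK mulmxA -QW QA.
have QT : Q^T = Q.
  have QTT : Q^T^T = Q^T by rewrite -QQ trmx_mul trmxK.
  by rewrite -QTT trmxK.
rewrite /orthoproj -/Q QT; split=> //; first by rewrite -{2}QT QQ.
by exists W^T; rewrite -QT QW trmx_mul trmxK.
Qed.

End Projections.

(** * Projections of families of blocks and their residual sums of squares *)

Section BlockProjections.
Context {R : realType} (n p : nat) (Z : 'M[R]_(n, p)).
Implicit Types (C X : {set 'I_n}) (D E F : {set {set 'I_n}}).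

(** Blocks differ in size, so their operators are lifted to [n] by [n] matrices, which can be added
    and compared; this one is the restriction to the coordinates in [C]. *)
Definition block_id C : 'M[R]_n := \matrix_(i, j) ((i == j) && (i \in C))%:R.

Definition block_sel C : 'M[R]_(#|C|, n) := block_rows C 1%:M.

Definition block_proj C : 'M[R]_n :=
  (block_sel C)^T *m orthoproj (block_rows C Z) *m block_sel C.

Lemma block_rowsE q (A : 'M[R]_(n, q)) C : block_rows C A = block_sel C *m A.
Proof. by rewrite /block_sel /block_rows mul_rowsub_mx mul1mx. Qed.

Lemma block_idE q (A : 'M[R]_(n, q)) C i j :
  (block_id C *m A) i j = A i j *+ (i \in C).
Proof.
rewrite mxE (bigD1 i)//= big1 => [|k ki]; rewrite !mxE.
  by rewrite eqxx/= addr0 mulr_natl.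
by rewrite eq_sym (negbTE ki) mul0r.
Qed.

Lemma block_selTsel C : (block_sel C)^T *m block_sel C = block_id C.
Proof.
apply/matrixP => i j; rewrite !mxE.
have [iC|iC] := boolP (i \in C).
  rewrite (bigD1 (enum_rank_in iC i))//= big1 => [|k ki]; rewrite !mxE.
    by rewrite enum_rankK_in// eqxx mul1r addr0 andbT.
  rewrite [_ == i](_ : _ = false) ?mul0r//.
  apply/negbTE; apply: contraNneq ki => ki.
  by rewrite -(enum_valK_in iC k) ki.
rewrite andbF big1// => k _; rewrite !mxE [_ == i](_ : _ = false) ?mul0r//.
by apply: contraNF iC => /eqP <-; exact: enum_valP.
Qed.

Lemma block_selT C : block_sel C *m (block_sel C)^T = 1%:M.
Proof.
apply/matrixP => i j; rewrite -block_rowsE !mxE eq_sym.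
by rewrite (inj_eq enum_val_inj) eq_sym.
Qed.

Lemma block_idT C : (block_id C)^T = block_id C.
Proof. by rewrite -block_selTsel trmx_mul trmxK. Qed.

Lemma block_id_sub C X : X \subset C -> block_id X *m block_id C = block_id X.
Proof.
move=> /fintype.subsetP XC; apply/matrixP => i j; rewrite block_idE !mxE.
by case: (boolP (i \in X)) => [/XC ->|]; rewrite ?andbF ?andbT ?mulr1n.
Qed.

Lemma block_id_disjoint C X : [disjoint X & C] -> block_id X *m block_id C = 0.
Proof.
move=> /pred0P XC; apply/matrixP => i j; rewrite block_idE !mxE.
have /= := XC i; case: (i \in X) => //= ->.
by rewrite andbF.
Qed.

Lemma block_projT C : (block_proj C)^T = block_proj C.
Proof.
have [PT _ _ _] := orthoproj_props (block_rows C Z).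
by rewrite /block_proj !trmx_mul PT trmxK mulmxA.
Qed.

Lemma block_proj_id C : block_proj C *m block_id C = block_proj C.
Proof.
by rewrite /block_proj -block_selTsel -!mulmxA (mulmxA _ _ (block_sel C))
  block_selT mul1mx.
Qed.

Lemma block_projZ C : block_proj C *m Z = block_id C *m Z.
Proof.
have [_ _ PZ _] := orthoproj_props (block_rows C Z).
by rewrite /block_proj -!mulmxA -block_rowsE PZ block_rowsE mulmxA block_selTsel.
Qed.

Lemma block_proj_factor C : exists W, block_proj C = block_id C *m Z *m W.
Proof.
have [_ _ _ [W PW]] := orthoproj_props (block_rows C Z).
exists (W *m block_sel C).
by rewrite /block_proj PW block_rowsE -!mulmxA -block_selTsel -!mulmxA.
Qed.

Lemma sqnormE m (u : 'cV[R]_m) : sqnorm u = (u^T *m u) 0 0.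
Proof. by rewrite !mxE; apply: eq_bigr => i _; rewrite !mxE expr2. Qed.

Lemma block_residual C (Y : 'cV[R]_n) :
  sqnorm ((1%:M - orthoproj (block_rows C Z)) *m block_rows C Y) =
  (Y^T *m (block_id C - block_proj C) *m Y) 0 0.
Proof.
have [PT PP _ _] := orthoproj_props (block_rows C Z).
rewrite -block_selTsel /block_proj; move: PT PP; set P := orthoproj _ => PT PP.
set S := block_sel C.
have QQ : (1%:M - P) *m (1%:M - P) = 1%:M - P.
  by rewrite mulmxBl mul1mx mulmxBr mulmx1 PP subrr subr0.
rewrite sqnormE block_rowsE -/S !trmx_mul linearB/= PT trmx1.
rewrite !mulmxA -(mulmxA _ (1%:M - P) (1%:M - P)) QQ.
have -> : S^T *m S - S^T *m P *m S = S^T *m (1%:M - P) *m S.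
  by rewrite mulmxBr mulmx1 mulmxBl.
by rewrite !mulmxA.
Qed.

Definition family_id F := \sum_(C in F) block_id C.

Definition family_proj F := \sum_(C in F) block_proj C.

Lemma rssE (Y : 'cV[R]_n) F :
  rss Z Y F = (Y^T *m (family_id F - family_proj F) *m Y) 0 0.
Proof.
rewrite /rss /family_id /family_proj -sumrB mulmx_sumr mulmx_suml summxE.
by apply: eq_bigr => C _; rewrite block_residual.
Qed.

Lemma family_idE F : finset.trivIset F -> family_id F = block_id (finset.cover F).
Proof.
move=> tF; apply/matrixP => i j; rewrite summxE mxE.
have [/finset.bigcupP[C CF iC]|iF] := boolP (i \in finset.cover F).
  rewrite (bigD1 C)//= big1 => [|X /andP[XF XC]]; rewrite !mxE ?iC ?addr0//.
  have := finset.trivIsetP tF _ _ XF CF XC.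
  by move=> /pred0P/(_ i)/=; rewrite iC andbT => ->; rewrite andbF.
rewrite andbF big1// => C CF; rewrite mxE.
case: (boolP (i \in C)) => iC; rewrite ?andbF//.
by case/negP: iF; apply/finset.bigcupP; exists C.
Qed.

Lemma family_projT F : (family_proj F)^T = family_proj F.
Proof.
by rewrite /family_proj linear_sum; apply: eq_bigr => C _; exact: block_projT.
Qed.

(** The hypothesis puts the restriction of [A] to each block in the range of the projection of that
    block. *)
Lemma family_proj_fit F q (A : 'M[R]_(n, q)) :
  (forall C, C \in F -> exists W, block_id C *m A = block_id C *m Z *m W) ->
  family_proj F *m A = family_id F *m A.
Proof.
move=> fit; rewrite !mulmx_suml; apply: eq_bigr => C /fit[W AW].
by rewrite -block_proj_id -mulmxA AW !mulmxA block_proj_id block_projZ.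
Qed.

(** Only a common union is asked for, so that this applies to the changed blocks of two
    configurations alone. *)
Definition refines E D :=
  [/\ finset.trivIset E, finset.cover E = finset.cover D &
      forall X, X \in E -> exists2 C, C \in D & X \subset C].

Lemma refines_sub_or_disjoint E D C X : finset.trivIset D -> refines E D ->
  C \in D -> X \in E -> X \subset C \/ [disjoint X & C].
Proof.
move=> tD [_ _ ED] CD /ED[C' C'D XC'].
have [<-|CC'] := eqVneq C' C; [by left|right].
by apply: disjointWl (finset.trivIsetP tD _ _ C'D CD CC').
Qed.

(** A column of [Z] restricted to [C] is still a column of [Z] on every piece of [C], so projecting
    piece by piece reproduces it. *)
Lemma family_proj_refines_block E D C : finset.trivIset D -> refines E D ->
  C \in D -> family_proj E *m (block_id C *m Z) = block_id C *m Z.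
Proof.
move=> tD ED CD; rewrite family_proj_fit => [|X XE].
  have [tE EDcover _] := ED.
  apply/matrixP => i j; rewrite family_idE// !block_idE EDcover -mulrnA mulnb.
  congr (_ *+ _); case: (boolP (i \in C)) => // iC.
  by have -> : i \in finset.cover D by apply/finset.bigcupP; exists C.
have [XC|XC] := refines_sub_or_disjoint tD ED CD XE.
  by exists 1%:M; rewrite mulmx1 mulmxA block_id_sub.
by exists 0; rewrite mulmx0 mulmxA block_id_disjoint// mul0mx.
Qed.

Lemma family_proj_refines E D : finset.trivIset D -> refines E D ->
  family_proj E *m family_proj D = family_proj D.
Proof.
move=> tD ED; rewrite {2 3}/family_proj mulmx_sumr; apply: eq_bigr => C CD.
have [W ->] := block_proj_factor C.
by rewrite mulmxA (family_proj_refines_block tD).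
Qed.

Lemma refines_refl D : finset.trivIset D -> refines D D.
Proof. by move=> tD; split=> // X XD; exists X. Qed.

(** The ranges are nested, so the difference is again an orthogonal projection. *)
Lemma family_proj_diff E D : finset.trivIset D -> refines E D ->
  let G := family_proj E - family_proj D in G^T = G /\ G *m G = G.
Proof.
move=> tD ED G; have [tE _ _] := ED.
have PED := family_proj_refines tD ED.
have PDE : family_proj D *m family_proj E = family_proj D.
  by rewrite -[LHS]trmxK trmx_mul !family_projT PED family_projT.
split; first by rewrite /G linearB/= !family_projT.
rewrite /G mulmxBl !mulmxBr PED PDE !(family_proj_refines _ (refines_refl _))//.
by rewrite subrr subr0.
Qed.

(** The range of [G] is spanned by the images of [block_id X *m Z] for [X] in [E]. As [G] kills
    [block_id C *m Z] for [C] in [D], the images of the pieces of [C] sum to zero, so one piece of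
    each [C] may be left out. Each remaining piece adds at most [p] to the rank. *)
Lemma rank_family_proj_diff E D (E1 : {set {set 'I_n}}) :
  finset.trivIset D -> refines E D -> E1 \subset E ->
  (forall X, X \in E -> X \notin E1 -> exists C,
    [/\ C \in D, X \subset C &
        forall X', X' \in E -> X' \subset C -> X' != X -> X' \in E1]) ->
  (\rank (family_proj E - family_proj D)%R <= p * #|E1|)%N.
Proof.
move=> tD ED E1E firstX; have [tE EDcover _] := ED.
set G := (_ - _)%R.
have PDE : family_proj D *m family_proj E = family_proj D.
  by rewrite -[LHS]trmxK trmx_mul !family_projT family_proj_refines// family_projT.
have GE : G = \sum_(X in E) G *m block_proj X.
  rewrite -mulmx_sumr -/(family_proj E) /G mulmxBl PDE.
  by rewrite (family_proj_refines _ (refines_refl _)).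
pose V := (\sum_(X in E1) <<(G *m (block_id X *m Z))^T>>)%MS.
have E1V X : X \in E1 -> ((G *m (block_id X *m Z))^T <= V)%MS.
  by move=> XE1; apply: (sumsmx_sup X) => //; rewrite genmxE.
have EV X : X \in E -> ((G *m (block_id X *m Z))^T <= V)%MS.
  move=> XE; have [/E1V//|/(firstX _ XE)[C [CD XC others]]] := boolP (X \in E1).
  have GC : G *m (block_id C *m Z) = 0.
    rewrite mulmxBl (family_proj_refines_block tD ED)//.
    by rewrite (family_proj_refines_block tD (refines_refl tD))// subrr.
  have idC : block_id C = \sum_(Y in E) block_id Y *m block_id C.
    rewrite -mulmx_suml -/(family_id E) family_idE// EDcover.
    rewrite -[RHS]trmxK trmx_mul !block_idT block_id_sub ?block_idT//.
    by apply/fintype.subsetP => i iC; apply/finset.bigcupP; exists C.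
  have : \sum_(Y in E) G *m (block_id Y *m block_id C *m Z) = 0.
    by rewrite -mulmx_sumr -mulmx_suml -idC.
  rewrite (bigD1 X)//= block_id_sub// => /eqP; rewrite addr_eq0 => /eqP.
  move=> ->; rewrite linearN eqmx_opp linear_sum/=.
  apply: summx_sub => Y /andP[YE YX].
  have [YC|YC] := refines_sub_or_disjoint tD ED CD YE.
    by rewrite block_id_sub//; apply/E1V/others.
  by rewrite block_id_disjoint// mul0mx mulmx0 trmx0 sub0mx.
rewrite -mxrank_tr.
have GV : (G^T <= V)%MS.
  rewrite GE linear_sum/=; apply: summx_sub => X XE.
  have [W ->] := block_proj_factor X.
  by rewrite mulmxA trmx_mul mulmx_sub// EV.
apply: (leq_trans (mxrankS GV)).
apply: (@leq_trans (\sum_(X in E1) p)%N); last by rewrite sum_nat_const mulnC.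
apply: (leq_trans (mxrank_sum_leqif _)).
by apply: leq_sum => X _ /=; rewrite genmxE; exact: rank_leq_row.
Qed.

(** The difference of the residual sums is the quadratic form of the projection [G], and [G] kills
    [theta]; with [G = U^T *m U] it becomes [sqnorm (U *m noise)]. *)
Lemma gaussian_rss_mgf E D (E1 : {set {set 'I_n}}) (s a : R) (theta : 'cV[R]_n) :
  0 < s -> 0 <= a < 1 ->
  finset.trivIset D -> refines E D -> E1 \subset E ->
  (forall X, X \in E -> X \notin E1 -> exists C,
    [/\ C \in D, X \subset C &
        forall X', X' \in E -> X' \subset C -> X' != X -> X' \in E1]) ->
  (forall C, C \in D ->
    exists W, block_id C *m theta = block_id C *m Z *m W) ->
  (\int[gaussian s theta]_y
    (expR (a / (2 * s ^+ 2) *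
       (rss Z (\col_i tnth y i) D - rss Z (\col_i tnth y i) E)))%:E <=
   ((Num.sqrt (1 - a))^-1 ^+ (p * #|E1|))%:E)%E.
Proof.
move=> s0 a01 tD ED E1E firstX fitD; have [tE EDcover EsubD] := ED.
pose G := family_proj E - family_proj D.
have [GT GG] : G^T = G /\ G *m G = G by exact: family_proj_diff.
have rG : (\rank G <= p * #|E1|)%N by exact: rank_family_proj_diff.
have [d [dG [U [UU UTU]]]] := orthonormal_factor GT GG.
have Gtheta : G *m theta = 0.
  rewrite mulmxBl !family_proj_fit ?family_idE ?EDcover ?subrr// => X.
  move=> /EsubD[C CD XC]; have [W CW] := fitD C CD.
  by exists W; rewrite -(block_id_sub XC) -!mulmxA CW -!mulmxA.
under eq_integral => y _.
  have -> : rss Z (\col_i tnth y i) D - rss Z (\col_i tnth y i) E =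
      sqnorm (U *m (\col_i tnth y i - theta)).
    set Y := \col_i _.
    rewrite !rssE sqnormE !family_idE// EDcover.
    have -> : (U *m (Y - theta))^T *m (U *m (Y - theta)) = Y^T *m G *m Y.
      rewrite trmx_mul mulmxA -(mulmxA _ U^T) UTU -mulmxA mulmxBr Gtheta subr0.
      rewrite linearB/= mulmxBl mulmxA (mulmxA theta^T) -{2}GT -trmx_mul Gtheta.
      by rewrite trmx0 mul0mx subr0.
    have -> : (forall (A B : 'M[R]_1), A 0 0 - B 0 0 = (A - B) 0 0).
      by move=> ? ?; rewrite !mxE.
    rewrite -mulmxBl -mulmxBr /G; congr ((_ *m _ *m _) 0 0).
    by rewrite opprB addrC addrA subrK.
  over.
rewrite gaussian_orthonormal_mgf// lee_fin.
(* The base is at least [1], so the exponent [d] may be raised to its upper bound. *)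
case/andP: a01 => a0 a1.
rewrite ler_weXn2l ?(leq_trans dG)// invf_ge1 ?sqrtr_gt0 ?subr_gt0//.
by rewrite -[leRHS]sqrtr1 ler_sqrt// gerBl.
Qed.

End BlockProjections.

(** * Most economical configurations *)

Section Blocks.
Context {n : nat}.
Implicit Types (B D E : {set {set 'I_n.+1}}) (C X : {set 'I_n.+1}).

Definition start C : 'I_n.+1 :=
  odflt ord0 [pick j in C | [forall i in C, (j <= i)%N]].

(** The exclusive right end; a natural number, because for the last block it is [n.+1], which is not
    an index. *)
Definition stop C : nat := (\max_(j in C) j).+1.

Definition starts B : {set 'I_n.+1} := start @: B.

Lemma startP C : C != finset.set0 ->
  start C \in C /\ forall i, i \in C -> (start C <= i)%N.
Proof.
move=> /set0Pn[i0 i0C]; rewrite /start; case: pickP => /= [j|none].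
  by case/andP => jC /forallP jmin; split=> // i iC; exact: (implyP (jmin i)).
have [j jC jmin] := @arg_minnP _ i0 (mem C) (@nat_of_ord _) i0C.
by have /andP[] := negbT (none j); split=> //; apply/forallP => i; apply/implyP/jmin.
Qed.

Lemma stopP C : C != finset.set0 -> exists2 j, j \in C & stop C = j.+1.
Proof.
move=> /set0Pn[i0 i0C].
have [|j jC jmax] := @eq_bigmax_cond _ (mem C) (fun j : 'I_n.+1 => j : nat).
  by rewrite card_gt0; apply/set0Pn; exists i0.
by exists j; rewrite // /stop jmax.
Qed.

Lemma lt_stop C j : j \in C -> (j < stop C)%N.
Proof. by move=> jC; rewrite ltnS (leq_bigmax_cond (F := @nat_of_ord _)). Qed.

Lemma stop_le C : (stop C <= n.+1)%N.
Proof. by rewrite ltnS; apply/bigmax_leqP => j _; rewrite -ltnS. Qed.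

(** A simple partition without the demand to cover all indices, so that subfamilies qualify. *)
Definition blocks_family D :=
  [&& finset.trivIset D, finset.set0 \notin D & [forall C in D, consecutive C]].

Lemma simple_partition_family B : simple_partition B -> blocks_family B.
Proof. by case/andP => /and3P[_ tB B0] cB; apply/and3P. Qed.

Lemma blocks_familyS D B : D \subset B -> blocks_family B -> blocks_family D.
Proof.
move=> DB /and3P[tB B0 /forallP cB]; apply/and3P; split.
- exact: finset.trivIsetS DB tB.
- by apply: contra B0; apply: (fintype.subsetP DB).
- apply/forallP => C; apply/implyP => /(fintype.subsetP DB) CB.
  exact: (implyP (cB C)).
Qed.

Lemma block_neq0 D C : blocks_family D -> C \in D -> C != finset.set0.
Proof. by move=> /and3P[_ D0 _] CD; apply: contraNneq D0 => <-. Qed.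

Lemma block_convex D C (i j k : 'I_n.+1) : blocks_family D -> C \in D ->
  i \in C -> k \in C -> (i <= j <= k)%N -> j \in C.
Proof.
move=> /and3P[_ _ /forallP/(_ C)/implyP cC] /cC.
move=> /forallP/(_ i)/implyP h /h /forallP/(_ k)/implyP {}h /h.
by move=> /forallP/(_ j)/implyP.
Qed.

Lemma block_eq D C X i : blocks_family D -> C \in D -> X \in D ->
  i \in C -> i \in X -> C = X.
Proof.
move=> /and3P[/finset.trivIsetP tD _ _] CD XD iC iX.
apply/eqP; apply: contraT => /(tD _ _ CD XD)/pred0P/(_ i).
by rewrite /= iC iX.
Qed.

Lemma start_inj D : blocks_family D -> {in D &, injective start}.
Proof.
move=> fD C X CD XD sCX.
have [sC _] := startP (block_neq0 fD CD).
have [sX _] := startP (block_neq0 fD XD).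
by apply: (block_eq fD CD XD sC); rewrite sCX.
Qed.

Lemma card_starts D : blocks_family D -> #|starts D| = #|D|.
Proof. by move=> fD; rewrite card_in_imset//; exact: start_inj. Qed.

Lemma start_in_block D C t : blocks_family D -> C \in D -> t \in starts D ->
  t \in C -> t = start C.
Proof.
move=> fD CD /imsetP[X XD ->] sXC; congr start.
have [sX _] := startP (block_neq0 fD XD).
exact: block_eq fD XD CD sX sXC.
Qed.

Lemma blockE D C j : blocks_family D -> C \in D ->
  (j \in C) = (start C <= j < stop C)%N.
Proof.
move=> fD CD; have C0 := block_neq0 fD CD; have [sC sCmin] := startP C0.
apply/idP/idP => [jC|/andP[sj js]]; first by rewrite sCmin// lt_stop.
have [k kC kE] := stopP C0.
by apply: (block_convex fD CD sC kC); rewrite sj -ltnS -kE.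
Qed.

Lemma blocks_family_starts_sub D E : blocks_family D -> blocks_family E ->
  finset.cover D = finset.cover E -> starts D = starts E -> D \subset E.
Proof.
move=> fD fE covDE stDE; apply/fintype.subsetP => C CD.
have [sC sCmin] := startP (block_neq0 fD CD).
have /imsetP[X XE sCX] : start C \in starts E by rewrite -stDE imset_f.
suff -> : C = X by [].
have [sX sXmin] := startP (block_neq0 fE XE).
(* Let [W] be the block of [F'] around [j]. If [W] starts no later than [Y], it contains the common
   start and equals [Y']. Otherwise its start is a start of [F] strictly inside [Y], which is
   impossible. *)
have inC j Y F : blocks_family F -> Y \in F -> forall Y' F', blocks_family F' ->
    Y' \in F' -> finset.cover F = finset.cover F' -> starts F = starts F' ->
    start Y = start Y' -> j \in Y -> j \in Y'.
  move=> fF YF Y' F' fF' Y'F' cov st sYY' jY.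
  have [sY sYmin] := startP (block_neq0 fF YF).
  have : j \in finset.cover F' by rewrite -cov; apply/finset.bigcupP; exists Y.
  move=> /finset.bigcupP[W WF' jW].
  have [sW sWmin] := startP (block_neq0 fF' WF').
  have [sY'] := startP (block_neq0 fF' Y'F').
  have [sWY|sYW] := leqP (start W) (start Y).
    suff -> : Y' = W by [].
    apply: (block_eq fF' Y'F' WF' sY'); rewrite -sYY'.
    by apply: (block_convex fF' WF' sW jW); rewrite sWY sYmin.
  have : start W = start Y.
    apply: (start_in_block fF YF); first by rewrite st imset_f.
    by apply: (block_convex fF YF sY jY); rewrite ltnW//= sWmin.
  by move=> sWE; rewrite sWE ltnn in sYW.
apply/setP => j; apply/idP/idP.
  exact: (inC j C D fD CD X E).
exact: (inC j X E fE XE C D).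
Qed.

Lemma blocks_family_starts_inj D E : blocks_family D -> blocks_family E ->
  finset.cover D = finset.cover E -> starts D = starts E -> D = E.
Proof.
by move=> fD fE cov st; apply/eqP; rewrite finset.eqEsubset !blocks_family_starts_sub.
Qed.

(** This numbers the cuts: for a cut [e] of [S] it is the number of [e], counted from zero. *)
Definition count_lt (S : {set 'I_n.+1}) (e : nat) := #|[set t in S | (t < e)%N]|.

Lemma count_lt_homo S e e' : (e <= e')%N -> (count_lt S e <= count_lt S e')%N.
Proof.
move=> ee'; apply: subset_leq_card; apply/fintype.subsetP => t.
by rewrite !inE => /andP[-> /leq_trans]; apply.
Qed.

Lemma count_lt_block B C u : blocks_family B -> C \in B -> u \in C ->
  count_lt (starts B) u.+1 = (count_lt (starts B) (start C)).+1.
Proof.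
move=> fB CB uC; have [sC sCmin] := startP (block_neq0 fB CB).
transitivity #|start C |: [set t in starts B | (t < start C)%N]|; last first.
  by rewrite cardsU1 !inE ltnn andbF.
rewrite /count_lt.
apply: eq_card => t; rewrite !inE ltnS.
have [->|tsC] /= := eqVneq t (start C); first by rewrite imset_f ?sCmin.
have [tB|//] /= := boolP (t \in starts B).
apply/idP/idP => [tu|tsC']; last by rewrite (leq_trans (ltnW tsC')) ?sCmin.
rewrite ltnNge; apply: contra tsC => sCt; apply/eqP.
by apply: (start_in_block fB CB tB); apply: (block_convex fB CB sC uC); rewrite sCt.
Qed.

Lemma count_lt_stop B C : blocks_family B -> C \in B ->
  count_lt (starts B) (stop C) = (count_lt (starts B) (start C)).+1.
Proof.
move=> fB CB; have [j jC ->] := stopP (block_neq0 fB CB).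
exact: count_lt_block.
Qed.

Lemma stop_in_starts B C (e : 'I_n.+1) : simple_partition B -> C \in B ->
  e = stop C :> nat -> e \in starts B.
Proof.
move=> sB CB eC; have fB := simple_partition_family sB.
have : e \in finset.cover B by case/andP: sB => /and3P[/eqP-> _ _] _; rewrite inE.
move=> /finset.bigcupP[X XB eX].
have [sX sXmin] := startP (block_neq0 fB XB).
suff -> : e = start X by rewrite imset_f.
apply/val_inj/eqP; rewrite /= eqn_leq sXmin// andbT leqNgt; apply/negP => sXe.
have [j jC jE] := stopP (block_neq0 fB CB).
have jX : j \in X.
  by apply: (block_convex fB XB sX eX); rewrite -ltnS -jE -eC sXe ltnW// eC jE.
have CX := block_eq fB CB XB jC jX.
by have := lt_stop (etrans (congr1 (fun A : {set _} => e \in A) CX) eX);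
  rewrite eC ltnn.
Qed.

End Blocks.

(** * Exchange arguments for minimal sets of cuts *)

Section MinimalConfigurations.
Context {R : realType} (K n : nat) (theta : 'cV[R]_n.+1).
Implicit Types (B : {set {set 'I_n.+1}}) (C X : {set 'I_n.+1}).
Implicit Types (S T : {set 'I_n.+1}).

Definition fits (a b : nat) : Prop :=
  exists2 p : {poly R}, (size p <= K.+1)%N &
    forall j : 'I_n.+1, (a <= j < b)%N -> theta j 0 = p.[j.+1%:R].

(** A cut at [t] separates [t] from its predecessor, so a cut at [a] does not split the interval
    from [a] to [b]; hence the strict inequality on the left. *)
Definition cuts_fit T : Prop :=
  forall a b, (forall t : 'I_n.+1, t \in T -> ~~ (a < t < b)%N) -> fits a b.

(** The two polynomials agree at the [b - c > K] indices of the overlap, so they are equal. *)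
Lemma fits_merge a c b d : (a <= c)%N -> (K < b - c)%N -> (b <= n.+1)%N ->
  fits a b -> fits c d -> fits a d.
Proof.
move=> ac Kbc bn [p sp pfit] [q sq qfit]; exists p => // j /andP[aj jd].
have [jb|bj] := ltnP j b; first by rewrite pfit// aj.
rewrite qfit ?jd ?andbT; last first.
  by rewrite (leq_trans _ bj)// ltnW// -subn_gt0 (leq_trans _ Kbc).
suff -> : p = q by [].
apply/eqP; rewrite -subr_eq0; apply: contraT => pq0.
pose rs : seq R := [seq i.+1%:R | i <- iota c (b - c)].
have : (size rs < size (p - q)%R)%N.
  apply: max_poly_roots => //.
  - apply/allP => x /mapP[i]; rewrite mem_iota => /andP[ci ib] ->.
    rewrite subnKC in ib; last by rewrite ltnW// -subn_gt0 (leq_trans _ Kbc).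
    have in' : (i < n.+1)%N by exact: leq_trans ib bn.
    rewrite rootE hornerD hornerN -(pfit (Ordinal in')) -?(qfit (Ordinal in'))/=.
    + by rewrite subrr.
    + by rewrite ci (leq_trans ib)// (leq_trans bj (ltnW jd)).
    + by rewrite (leq_trans ac ci).
  - rewrite map_inj_uniq ?iota_uniq// => i k /eqP.
    by rewrite eqr_nat => /eqP[].
rewrite size_map size_iota ltnNge => /negP[].
apply: leq_trans (size_polyD _ _) _; rewrite size_polyN geq_max.
by rewrite !(leq_trans _ Kbc).
Qed.

Lemma starts_cuts_fit B : simple_partition B -> piecewise_poly K theta B ->
  cuts_fit (starts B).
Proof.
move=> sB pB a b noT; have fB := simple_partition_family sB.
have [an|na] := ltnP a n.+1; last first.
  exists 0 => [|j /andP[aj _]]; first by rewrite size_poly0.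
  by have := leq_trans (ltn_ord j) (leq_trans na aj); rewrite ltnn.
have covB x : x \in finset.cover B.
  by case/andP: sB => /and3P[/eqP-> _ _] _; rewrite inE.
have /finset.bigcupP[C CB aC] := covB (Ordinal an).
have [p sp pfit] := pB C CB; exists p => // j /andP[aj jb]; apply: pfit.
have /finset.bigcupP[X XB jX] := covB j.
have [sX sXmin] := startP (block_neq0 fB XB).
suff aX : Ordinal an \in X by rewrite (block_eq fB CB XB aC aX).
apply: (block_convex fB XB sX jX); rewrite /= aj andbT leqNgt; apply/negP => asX.
have /negP[] := noT (start X) (imset_f _ XB).
by rewrite asX (leq_ltn_trans (sXmin _ jX)).
Qed.

(** The blocks are the level sets of the number of cuts up to [j]. Index [ord0] always starts a
    block, whether or not it belongs to [T]. *)
Lemma cuts_fit_partition T : cuts_fit T ->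
  exists B, [/\ simple_partition B, piecewise_poly K theta B &
                (#|B| <= #|ord0 |: T|)%N].
Proof.
move=> fT; pose f (j : 'I_n.+1) := count_lt T j.+1.
pose B := finset.preim_partition f [set: 'I_n.+1].
have pB : finset.partition B [set: 'I_n.+1] := finset.preim_partitionP f _.
have fhomo (i j : 'I_n.+1) : (i <= j)%N -> (f i <= f j)%N.
  by move=> ij; exact: count_lt_homo.
have fcut (i j t : 'I_n.+1) : t \in T -> (i < t <= j)%N -> (f i < f j)%N.
  move=> tT /andP[it tj]; rewrite /f /count_lt; apply: proper_card.
  apply/properP; split.
    apply/fintype.subsetP => u; rewrite !inE !ltnS => /andP[-> ui] /=.
    by rewrite (leq_trans ui)// ltnW// (leq_trans it).
  by exists t; rewrite !inE tT//= ltnS -ltnNge.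
have memB C i j : C \in B -> i \in C -> (j \in C) = (f i == f j).
  move=> CB iC; have [/eqP covB tB _] := and3P pB.
  rewrite -(finset.def_pblock tB CB iC).
  rewrite (finset.pblock_equivalence_partition (R := fun x y => f x == f y)) ?inE//.
  by move=> x y z _ _ _; split=> [|/eqP ->].
have sB : simple_partition B.
  rewrite /simple_partition pB /=; apply/forallP => C; apply/implyP => CB.
  apply/forallP => i; apply/implyP => iC; apply/forallP => k; apply/implyP => kC.
  apply/forallP => j; apply/implyP => /andP[ij jk]; rewrite (memB _ i)//.
  have := kC; rewrite (memB _ i)// => /eqP fik.
  by rewrite eqn_leq fhomo// fik fhomo.
have fB := simple_partition_family sB.
exists B; split=> //.
  move=> C CB; have [p sp pfit] : fits (start C) (stop C).
    apply: fT => t tT; apply/negP => /andP[st ts].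
    have [sC _] := startP (block_neq0 fB CB).
    have [k kC kE] := stopP (block_neq0 fB CB).
    have := kC; rewrite (memB _ _ k CB sC) => /eqP fsk.
    by have := fcut (start C) k t tT; rewrite fsk ltnn st -ltnS -kE => /(_ ts).
  by exists p => // j; rewrite (blockE _ fB CB) => /pfit.
rewrite -(card_starts fB); apply: subset_leq_card; apply/fintype.subsetP => t.
move=> /imsetP[C CB ->]; rewrite !inE orbC; apply: contraT; rewrite negb_or.
move=> /andP[sT s0]; have [sC sCmin] := startP (block_neq0 fB CB).
(* Otherwise the predecessor of [start C] has the same count and lies in [C], against the choice of
   [start C]. *)
have s_gt0 : (0 < start C)%N by rewrite lt0n.
have s1n : ((start C).-1 < n.+1)%N by rewrite (leq_ltn_trans (leq_pred _)).
have : Ordinal s1n \in C.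
  rewrite (memB _ _ _ CB sC) /f /= prednK// /count_lt; apply/eqP/eq_card => u.
  rewrite !inE ltnS; have [uT|//] /= := boolP (u \in T).
  rewrite leq_eqVlt; case: eqP => // /val_inj us.
  by rewrite us (negbTE sT) in uT.
by move=> /sCmin /=; rewrite leqNgt prednK ?leqnn.
Qed.

Definition minimal_cuts S := [/\ cuts_fit S, ord0 \in S &
  forall T, cuts_fit T -> (#|S| <= #|ord0 |: T|)%N].

Lemma most_economical_cuts B : most_economical K theta B ->
  minimal_cuts (starts B).
Proof.
move=> [sB pB minB]; have fB := simple_partition_family sB; split.
- exact: starts_cuts_fit.
- have : ord0 \in finset.cover B.
    by case/andP: sB => /and3P[/eqP-> _ _] _; rewrite inE.
  move=> /finset.bigcupP[C CB C0]; have [_ /(_ _ C0)] := startP (block_neq0 fB CB).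
  rewrite leqn0 => /eqP s0; have -> : ord0 = start C by apply/val_inj.
  exact: imset_f.
- move=> T /cuts_fit_partition[B' [sB' pB' B'T]].
  by rewrite card_starts// (leq_trans (minB B' sB' pB')).
Qed.

Lemma minimal_cuts_card S S' : minimal_cuts S -> minimal_cuts S' -> #|S| = #|S'|.
Proof.
move=> [fS S0 minS] [fS' S'0 minS']; apply/eqP; rewrite eqn_leq.
have := minS _ fS'; have := minS' _ fS.
have U1 T : ord0 \in T -> ord0 |: T = T.
  by move=> T0; apply/setP => x; rewrite !inE; case: eqP => // ->.
by rewrite !U1// => -> ->.
Qed.

Lemma card_above S e : #|S| = (count_lt S e + #|[set t in S | (e <= t)%N]|)%N.
Proof.
rewrite /count_lt -cardsUI [X in (_ + X)%N](_ : _ = 0).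
  rewrite addn0; apply: eq_card => t; rewrite !inE.
  by case: (t \in S) => //=; case: ltnP.
apply/eqP; rewrite cards_eq0; apply/eqP/setP => t; rewrite !inE.
by case: (t \in S) => //=; case: ltnP.
Qed.

(* Cutting as [S] does to the left of [e], at [e], and as [S'] does to the
   right of [e] is admissible. *)
Lemma minimal_cuts_splice S S' (e : 'I_n.+1) :
  minimal_cuts S -> minimal_cuts S' -> (count_lt S' e.+1 <= (count_lt S e).+1)%N.
Proof.
move=> mS mS'; have SS' := minimal_cuts_card mS mS'.
have [fS S0 minS] := mS; have [fS' S'0 minS'] := mS'.
pose T := e |: ([set t in S | (t < e)%N] :|: [set t in S' | (e.+1 <= t)%N]).
have fT : cuts_fit T.
  move=> a b noT; have [ba|ab] := leqP b e.
    apply: fS => t tS; apply/negP => /andP[at' tb].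
    suff tT : t \in T by have := noT t tT; rewrite at' tb.
    by rewrite !inE tS (leq_trans tb ba) orbT.
  apply: fS' => t tS; apply/negP => /andP[at' tb].
  suff tT : t \in T by have := noT t tT; rewrite at' tb.
  rewrite !inE tS /= (leq_ltn_trans _ at') ?orbT// leqNgt; apply/negP => ae.
  by have := noT e; rewrite !inE eqxx ae ab => /(_ isT).
have T0 : ord0 |: T = T.
  apply/setP => x; rewrite !inE; case: eqP => //= ->; rewrite S0 /=.
  have [e0|e0] := posnP e; last by rewrite orbT.
  by rewrite (_ : ord0 == e) //; apply/eqP/val_inj.
have := minS T fT; rewrite T0 => /leq_trans/(_ (leq_card_setU _ _)).
rewrite cards1 => /leq_trans; rewrite -(leq_add2l 0%N).
move=> /(_ (1 + (count_lt S e + #|[set t in S' | (e.+1 <= t)%N]|))%N).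
rewrite leq_add2l leq_card_setU => /(_ isT).
by rewrite SS' (card_above S' e.+1) !addnA leq_add2r add1n.
Qed.

(* Dropping the cut [e] of [S] and all cuts of [S] before it in favour of those
   of [S'] before [e'] saves a block; this is admissible as soon as [S] and [S']
   share a block of more than [K] indices between [e] and [e']. *)
Lemma minimal_cuts_close S S' (e : 'I_n.+1) (e' : nat) :
  minimal_cuts S -> minimal_cuts S' -> e \in S -> (e < e' <= n.+1)%N ->
  (count_lt S' e' <= count_lt S e)%N -> (e' - e <= K)%N.
Proof.
move=> mS mS' eS /andP[ee' e'n] cc; have SS' := minimal_cuts_card mS mS'.
have [fS S0 minS] := mS; have [fS' S'0 minS'] := mS'.
rewrite leqNgt; apply/negP => Kee'.
pose T := [set t in S' | (t < e')%N] :|: [set t in S | (e.+1 <= t)%N].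
have fT : cuts_fit T.
  move=> a b noT.
  have left_fit c : (c <= e')%N -> (c <= b)%N -> fits a c.
    move=> ce' cb; apply: fS' => t tS; apply/negP => /andP[at' tc].
    suff tT : t \in T by have := noT t tT; rewrite at' (leq_trans tc cb).
    by rewrite !inE tS (leq_trans tc).
  have right_fit c : (e <= c)%N -> (a <= c)%N -> fits c b.
    move=> ec ac; apply: fS => t tS; apply/negP => /andP[ct tb].
    suff tT : t \in T by have := noT t tT; rewrite tb (leq_ltn_trans ac ct).
    by rewrite !inE tS (leq_ltn_trans ec ct) orbT.
  have [be'|e'b] := leqP b e'; first exact: left_fit.
  have [ea|ae] := leqP e a; first exact: right_fit.
  apply: (@fits_merge a e e' b) => //; first exact: ltnW.
    by apply: left_fit => //; exact: ltnW.
  by apply: right_fit => //; exact: ltnW.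
have T0 : ord0 |: T = T.
  apply/setP => x; rewrite !inE; case: eqP => //= ->.
  by rewrite S'0 (leq_trans _ ee').
have := minS T fT; rewrite T0 => /leq_trans/(_ (leq_card_setU _ _)).
apply/negP; rewrite -ltnNge (card_above S e.+1) -/(count_lt S' e') ltn_add2r.
apply: (leq_ltn_trans cc); apply: proper_card; apply/properP; split.
  by apply/fintype.subsetP => t; rewrite !inE => /andP[->] /ltnW.
by exists e; rewrite !inE eS//= ltnn.
Qed.

Lemma eq_of_modn x y m : x = y %[mod m.+1] -> (x <= y -> y - x <= m)%N ->
  (x <= y)%N -> x = y.
Proof.
move=> xy /[swap] xley /(_ xley) yx.
have : (m.+1 %| y - x)%N by rewrite -eqn_mod_dvd// eq_sym; apply/eqP.
move=> /dvdn_leq; case: (posnP (y - x)) => [/eqP|yx0 /(_ isT)].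
  by rewrite subn_eq0 => ? _; apply/eqP; rewrite eqn_leq xley.
by move=> /leq_trans/(_ yx); rewrite ltnn.
Qed.

(** By [minimal_cuts_splice] the numbers of two blocks sharing [u] differ by at most one, so their
    parity decides them. With equal numbers, [minimal_cuts_close] puts the starts, and likewise the
    stops, at most [K] apart, so residues modulo [K.+1] decide these. *)
Lemma economical_block_inj B B' C C' u :
  most_economical K theta B -> most_economical K theta B' ->
  C \in B -> C' \in B' -> u \in C -> u \in C' ->
  odd (count_lt (starts B) (start C)) = odd (count_lt (starts B') (start C')) ->
  start C = start C' %[mod K.+1] -> stop C = stop C' %[mod K.+1] -> C = C'.
Proof.
wlog : B B' C C' / (count_lt (starts B) (start C) <= count_lt (starts B') (start C'))%N.
  move=> W eB eB' CB C'B' uC uC' par sm tm.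
  case: (leqP (count_lt (starts B) (start C)) (count_lt (starts B') (start C'))).
    by move=> le; apply: (W B B').
  by move=> /ltnW le; apply/esym/(W B' B).
move=> ii' eB eB' CB C'B' uC uC' par sm tm.
have mB := most_economical_cuts eB; have mB' := most_economical_cuts eB'.
have [sB _ _] := eB; have [sB' _ _] := eB'.
have fB := simple_partition_family sB; have fB' := simple_partition_family sB'.
have eqii' : count_lt (starts B) (start C) = count_lt (starts B') (start C').
  have := minimal_cuts_splice u mB mB'.
  rewrite (count_lt_block fB' C'B' uC') ltnS => le.
  have := count_lt_homo (starts B) (leqnSn u).
  rewrite (count_lt_block fB CB uC) => /(leq_trans le).
  move: ii' par; set i := count_lt _ _; set i' := count_lt _ _.
  rewrite leq_eqVlt => /orP[/eqP//|ii'] par i'i.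
  have i'E : i' = i.+1 by apply/eqP; rewrite eqn_leq ii' i'i.
  by move: par; rewrite i'E /=; case: (odd i).
have startE : start C = start C' :> nat.
  have [le|/ltnW le] := leqP (start C) (start C'); [|apply/esym]; move: le;
      (apply: (@eq_of_modn _ _ K); first by []); rewrite leq_eqVlt => /orP[/eqP->|lt];
      rewrite ?subnn//.
    apply: (minimal_cuts_close mB mB' (imset_f _ CB)); last by rewrite eqii'.
    by rewrite lt ltnW.
  apply: (minimal_cuts_close mB' mB (imset_f _ C'B')); last by rewrite eqii'.
  by rewrite lt ltnW.
have stopE : stop C = stop C'.
  have [le|/ltnW le] := leqP (stop C) (stop C'); [|apply/esym]; move: le;
      (apply: (@eq_of_modn _ _ K); first by []); rewrite leq_eqVlt => /orP[/eqP->|lt];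
      rewrite ?subnn//.
    (* The smaller stop is an index, hence a cut, and both stops have the number following that of
       the starts. *)
    have sn : (stop C < n.+1)%N by rewrite (leq_trans lt)// stop_le.
    apply: (@minimal_cuts_close _ _ (Ordinal sn) _ mB mB').
    - exact: stop_in_starts sB CB _.
    - by rewrite lt stop_le.
    - by rewrite (count_lt_stop fB' C'B') (count_lt_stop fB CB) eqii'.
  have sn : (stop C' < n.+1)%N by rewrite (leq_trans lt)// stop_le.
  apply: (@minimal_cuts_close _ _ (Ordinal sn) _ mB' mB).
  - exact: stop_in_starts sB' C'B' _.
  - by rewrite lt stop_le.
  - by rewrite (count_lt_stop fB' C'B') (count_lt_stop fB CB) eqii'.
by apply/setP => j; rewrite (blockE _ fB CB) (blockE _ fB' C'B') startE stopE.
Qed.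

Definition economical_blocks (u : 'I_n.+1) : {set {set 'I_n.+1}} :=
  [set C : {set 'I_n.+1} | (u \in C) &&
     `[< exists2 B, most_economical K theta B & C \in B >]].

(** By [economical_block_inj] a block around [u] is coded by one parity and two residues modulo
    [K.+1]; [conf] picks a configuration in which the parity is read. *)
Lemma card_economical_blocks u : (#|economical_blocks u| <= 2 * K.+1 ^ 2)%N.
Proof.
pose conf (C : {set 'I_n.+1}) : {set {set 'I_n.+1}} := odflt finset.set0
  [pick B : {set {set 'I_n.+1}} | `[< most_economical K theta B >] && (C \in B)].
have confP C : C \in economical_blocks u ->
    [/\ u \in C, most_economical K theta (conf C) & C \in conf C].
  rewrite inE => /andP[uC /asboolP[B eB CB]]; rewrite /conf.
  case: pickP => [B' /andP[/asboolP eB' CB']|/(_ B)] //.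
  by rewrite CB asboolT.
pose code C := (odd (count_lt (starts (conf C)) (start C)),
  (inord (start C %% K.+1) : 'I_K.+1, inord (stop C %% K.+1) : 'I_K.+1)).
have code_inj : {in economical_blocks u &, injective code}.
  move=> C C' /confP[uC eB CB] /confP[uC' eB' CB'] [par sm tm].
  apply: (economical_block_inj eB eB' CB CB' uC uC' par).
  - by have := congr1 val sm; rewrite /= !inordK ?ltn_mod.
  - by have := congr1 val tm; rewrite /= !inordK ?ltn_mod.
rewrite -(card_in_imset code_inj); apply: leq_trans (max_card _) _.
by rewrite !card_prod card_bool !card_ord.
Qed.

End MinimalConfigurations.

(** * Counting refinements *)

Section Refinements.
Context {n : nat}.
Implicit Types (B D E : {set {set 'I_n.+1}}) (C X : {set 'I_n.+1}).

Definition new_starts D E := starts E :\: starts D.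

Context (B0 B : {set {set 'I_n.+1}}).
Context (sB0 : simple_partition B0) (sB : simple_partition B).
Context (BB0 : strict_refinement B B0).

Let D := B0 :\: B.
Let E := B :\: B0.

Let fB0 := simple_partition_family sB0.
Let fB := simple_partition_family sB.

Lemma removed_blocks_family : blocks_family D.
Proof. by apply: blocks_familyS fB0; exact: subsetDl. Qed.

Lemma added_blocks_family : blocks_family E.
Proof. by apply: blocks_familyS fB; exact: subsetDl. Qed.

Let block_cover C i : C \in B0 -> i \in C ->
  exists X, [/\ X \in B, i \in X & X \subset C].
Proof.
case/andP: BB0 => _ /forallP/(_ C)/implyP h CB0 iC.
have /existsP[S /andP[SB /eqP CE]] := h CB0.
have := iC; rewrite {1}CE => /finset.bigcupP[X XS iX].
exists X; split=> //; first exact: (fintype.subsetP SB).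
by rewrite CE; apply: (finset.bigcup_sup X).
Qed.

Let B_sub X : X \in B -> exists2 C, C \in B0 & X \subset C.
Proof.
move=> XB; have [iX _] := startP (block_neq0 fB XB).
have : start X \in finset.cover B0.
  by case/andP: sB0 => /and3P[/eqP-> _ _] _; rewrite inE.
move=> /finset.bigcupP[C CB0 iC]; exists C => //.
have [X' [X'B iX' X'C]] := block_cover CB0 iC.
by rewrite (block_eq fB XB X'B iX iX').
Qed.

Lemma strict_refinement_refines : refines E D.
Proof.
have subED X : X \in E -> exists2 C, C \in D & X \subset C.
  rewrite inE => /andP[XB0 XB]; have [C CB0 XC] := B_sub XB.
  exists C => //; rewrite inE CB0 andbT; apply: contra XB0 => CB.
  have [sX _] := startP (block_neq0 fB XB).
  by rewrite (block_eq fB XB CB sX (fintype.subsetP XC _ sX)).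
have /and3P[tE _ _] := added_blocks_family.
split=> //; apply/setP => i; apply/finset.bigcupP/finset.bigcupP => [[X XE iX]|[C CD iC]].
  by have [C CD XC] := subED X XE; exists C => //; exact: (fintype.subsetP XC).
have := CD; rewrite inE => /andP[CB CB0].
have [X [XB iX XC]] := block_cover CB0 iC.
exists X => //; rewrite inE XB andbT; apply: contra CB => XB0.
by rewrite (block_eq fB0 CB0 XB0 iC iX).
Qed.

Let startsDE : starts D \subset starts E.
Proof.
apply/fintype.subsetP => _ /imsetP[C CD ->].
have [_ EDcover subED] := strict_refinement_refines.
have fD := removed_blocks_family; have fE := added_blocks_family.
have [sC sCmin] := startP (block_neq0 fD CD).
have : start C \in finset.cover E.
  by rewrite EDcover; apply/finset.bigcupP; exists C.
move=> /finset.bigcupP[X XE sCX]; have [C' C'D XC'] := subED X XE.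
have [sX sXmin] := startP (block_neq0 fE XE).
have CC' := block_eq fD CD C'D sC (fintype.subsetP XC' _ sCX).
suff -> : start C = start X by exact: imset_f.
apply/val_inj/eqP; rewrite /= eqn_leq sXmin// andbT sCmin//.
by rewrite CC'; exact: (fintype.subsetP XC').
Qed.

(** Refining keeps every old start; thus the removed blocks and the new starts determine the added
    blocks. *)
Lemma starts_added_blocks : starts E = starts D :|: new_starts D E.
Proof.
rewrite /new_starts finset.setDE finset.setUIr finset.setUCr finset.setIT.
by apply/esym/finset.setUidPr; exact: startsDE.
Qed.

Lemma card_new_starts : #|B| = (#|B0| + #|new_starts D E|)%N.
Proof.
rewrite /new_starts cardsDS// !card_starts ?removed_blocks_family
  ?added_blocks_family//.
have DE : (#|D| <= #|E|)%N.
  rewrite -(card_starts removed_blocks_family) -(card_starts added_blocks_family).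
  exact: subset_leq_card.
have := cardsID B0 B; have := cardsID B B0.
by rewrite finset.setIC -/D -/E; lia.
Qed.

(** The piece of [C] holding its start is not all of [C], since pieces are not blocks of [B0]. Any
    index of [C] outside it lies in a later piece, whose start is new. *)
Lemma removed_block_new_start C : C \in D -> exists2 u, u \in new_starts D E & u \in C.
Proof.
move=> CD; have [tE EDcover subED] := strict_refinement_refines.
have fD := removed_blocks_family; have fE := added_blocks_family.
have [sC sCmin] := startP (block_neq0 fD CD).
have coverE i : i \in C -> exists X, [/\ X \in E, i \in X & X \subset C].
  move=> iC; have : i \in finset.cover E.
    by rewrite EDcover; apply/finset.bigcupP; exists C.
  move=> /finset.bigcupP[X XE iX]; exists X; split=> //.
  have [C' C'D XC'] := subED X XE.
  by rewrite (block_eq fD CD C'D iC (fintype.subsetP XC' _ iX)).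
have [X [XE sCX XC]] := coverE _ sC.
have : ~~ (C \subset X).
  apply/negP => CX; have CXE : C = X by apply/eqP; rewrite finset.eqEsubset CX.
  by move: XE CD; rewrite -CXE !inE => /andP[/negP + _] /andP[_ CB0]; apply.
move=> /fintype.subsetPn[i iC iX].
have [X' [X'E iX' X'C]] := coverE _ iC.
have [sX' _] := startP (block_neq0 fE X'E).
have sX'C := fintype.subsetP X'C _ sX'.
exists (start X') => //; apply/finset.setDP; split; first exact: imset_f.
apply: contra iX => sX'D.
have sE := start_in_block fD CD sX'D sX'C.
by rewrite (block_eq fE XE X'E sCX)// -sE.
Qed.

Lemma new_starts_gt0 : (0 < #|new_starts D E|)%N.
Proof.
rewrite card_gt0; apply/eqP => U0.
have D0 C : C \notin D.
  by apply/negP => /removed_block_new_start[u]; rewrite U0 inE.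
have [_ _ subED] := strict_refinement_refines.
have : B != B0 by case/andP: BB0.
move=> /eqP[]; apply/eqP; rewrite finset.eqEsubset; apply/andP; split.
  apply/fintype.subsetP => X XB; apply: contraT => XB0.
  have [|C CD _] := subED X; first by rewrite inE XB0.
  by have := D0 C; rewrite CD.
apply/fintype.subsetP => C CB0; apply: contraT => CB.
by have := D0 C; rewrite inE CB CB0.
Qed.

(** Of each removed block, the piece with its start is left out; this is the family [E1] of
    [rank_family_proj_diff]. *)
Definition nonfirst_blocks := [set X in E | start X \notin starts D].

Lemma card_nonfirst_blocks : #|nonfirst_blocks| = #|new_starts D E|.
Proof.
have fE := added_blocks_family.
rewrite -(@card_in_imset _ _ start); last first.
  move=> X X'; rewrite !inE => /andP[/andP[XB0 XB] _] /andP[/andP[X'B0 X'B] _].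
  exact: (start_inj fB).
apply: eq_card => t; rewrite /new_starts [RHS]inE.
apply/imsetP/andP => [[X]|[tD /imsetP[X XE tX]]].
  by rewrite [X \in _]inE => /andP[XE sX] ->; rewrite sX imset_f.
by exists X; rewrite // [X \in _]inE XE -tX.
Qed.

Lemma nonfirst_blocks_complement X : X \in E -> X \notin nonfirst_blocks ->
  exists C, [/\ C \in D, X \subset C &
    forall X', X' \in E -> X' \subset C -> X' != X -> X' \in nonfirst_blocks].
Proof.
move=> XE; rewrite inE XE /= negbK => sXD.
have fD := removed_blocks_family; have fE := added_blocks_family.
have [_ _ subED] := strict_refinement_refines; have [C CD XC] := subED X XE.
exists C; split=> // X' X'E X'C; rewrite [X' \in nonfirst_blocks]inE X'E /=.
apply: contra => sX'D.
have [sX _] := startP (block_neq0 fE XE); have [sX' _] := startP (block_neq0 fE X'E).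
have sXC := start_in_block fD CD sXD (fintype.subsetP XC _ sX).
have sX'C := start_in_block fD CD sX'D (fintype.subsetP X'C _ sX').
by apply/eqP/(start_inj fE) => //; rewrite sXC.
Qed.

End Refinements.

(** * Number of pairs of removed and added blocks *)

Section RefinementKeys.
Context {R : realType} (K n : nat) (theta : 'cV[R]_n.+1).
Local Notation config := {set {set 'I_n.+1}}.

Definition refinement_key (k : config * config) : Prop :=
  exists B0 B, [/\ most_economical K theta B0, simple_partition B,
    strict_refinement B B0 & k = (B0 :\: B, B :\: B0)].

Definition refinement_keys (m : nat) : {set config * config} :=
  [set k | `[< refinement_key k >] && (#|new_starts k.1 k.2| == m)].

Lemma refinement_keysP m k :
  reflect (refinement_key k /\ #|new_starts k.1 k.2| = m) (k \in refinement_keys m).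
Proof.
rewrite finset.in_set; apply: (iffP andP) => -[kk /eqP km]; split=> //.
- exact/asboolP.
- exact/asboolP.
Qed.

(** The binomial coefficient counts the sets [A] of new cuts. Given [A], the removed blocks are
    obtained by selecting for each cut in [A] an economical block around it. *)
Lemma card_refinement_keys m :
  (#|refinement_keys m| <= 'C(n.+1, m) * (2 * K.+1 ^ 2) ^ m)%N.
Proof.
set L := (2 * K.+1 ^ 2)%N.
pose U (k : config * config) := new_starts k.1 k.2.
have keyU k : k \in refinement_keys m -> U k \in [set A : {set 'I_n.+1} | #|A| == m].
  by move=> /refinement_keysP[_ km]; rewrite finset.in_set; apply/eqP.
(* Off [A] the only value is the empty set, so just [m] coordinates of a selection are free. *)
pose F (A : {set 'I_n.+1}) (u : 'I_n.+1) :=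
  if u \in A then economical_blocks K theta u else [set finset.set0].
have card_fiber (A : {set 'I_n.+1}) : #|A| = m ->
    (#|[set k in refinement_keys m | U k == A]| <= L ^ m)%N.
  move=> Am.
  pose Ds := [set (f : {ffun 'I_n.+1 -> {set 'I_n.+1}}) @: A | f in
    family (fun u => mem (F A u))].
  have fiberP k : k \in [set k in refinement_keys m | U k == A] ->
      refinement_key k /\ U k = A.
    by rewrite finset.in_set => /andP[/refinement_keysP[? _] /eqP].
  (* The added blocks are recovered from the removed ones: they have the same union, and their
     starts are the old starts together with [A]. *)
  have inj1 : {in [set k in refinement_keys m | U k == A] &, injective fst}.
    move=> k k' /fiberP[[B0 [B [eB0 sB BB0 kE]]] UA].
    move=> /fiberP[[B0' [B' [eB0' sB' BB0' k'E]]] UA'].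
    rewrite kE in UA *; rewrite k'E in UA' * => /= DD'.
    congr (_, _) => //.
    have [sB0 _ _] := eB0; have [sB0' _ _] := eB0'.
    have [_ cE _] := strict_refinement_refines sB0 sB BB0.
    have [_ cE' _] := strict_refinement_refines sB0' sB' BB0'.
    apply: blocks_family_starts_inj.
    - exact: added_blocks_family.
    - exact: added_blocks_family.
    - by rewrite cE cE' DD'.
    - rewrite (starts_added_blocks sB0 sB BB0) (starts_added_blocks sB0' sB' BB0').
      by move: UA UA'; rewrite /U /= => -> ->; rewrite DD'.
  rewrite -(card_in_imset inj1); apply: (@leq_trans #|Ds|).
    apply: subset_leq_card; apply/fintype.subsetP => D.
    move=> /imsetP[k /fiberP[[B0 [B [eB0 sB BB0 kE]]] UA] ->].
    rewrite kE in UA *; rewrite /=.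
    have [sB0 _ _] := eB0; have fD := removed_blocks_family B sB0.
    set D0 := B0 :\: B in fD *.
    have blockin u : u \in A -> exists2 C, C \in D0 & u \in C.
      rewrite -UA /U /= => uU.
      have [_ cE _] := strict_refinement_refines sB0 sB BB0.
      have : u \in finset.cover D0.
        rewrite -cE; move: uU; rewrite inE => /andP[_ /imsetP[X XE ->]].
        apply/finset.bigcupP; exists X => //.
        by have [] := startP (block_neq0 (added_blocks_family B0 sB) XE).
      by move=> /finset.bigcupP[C CD uC]; exists C.
    (* Each new cut is sent to the removed block around it; every removed block is reached, as it
       contains a new cut. *)
    apply/imsetP; exists [ffun u => if u \in A then finset.pblock D0 u else finset.set0].
      apply/familyP => u; rewrite ffunE /F; case: ifPn => [uA|]; last by rewrite inE.
      have [C CD uC] := blockin u uA; have /and3P[tD _ _] := fD.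
      rewrite (finset.def_pblock tD CD uC) inE uC; apply/asboolP.
      by exists B0 => //; move: CD; rewrite inE => /andP[].
    apply/setP => C; apply/idP/imsetP => [CD|[u uA ->]].
      have [u uU uC] := removed_block_new_start sB0 sB BB0 CD.
      have uA : u \in A by rewrite -UA.
      exists u => //; rewrite ffunE uA; have /and3P[tD _ _] := fD.
      by rewrite (finset.def_pblock tD CD uC).
    rewrite ffunE uA; have [C' C'D uC'] := blockin u uA; have /and3P[tD _ _] := fD.
    by rewrite (finset.def_pblock tD C'D uC').
  apply: leq_trans (leq_imset_card _ _) _.
  rewrite card_family foldrE big_image /= -Am -prod_nat_const.
  rewrite [X in (_ <= X)%N]big_mkcond /=; apply: leq_prod => u _.
  rewrite /F; case: ifP => uA; last by rewrite cards1.
  exact: card_economical_blocks.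
rewrite -sum1_card (partition_big U (fun A => A \in [set A : {set 'I_n.+1} | #|A| == m])) //=.
apply: (@leq_trans (\sum_(A in [set A : {set 'I_n.+1} | #|A| == m]) L ^ m)%N).
  apply: leq_sum => A; rewrite inE => /eqP Am.
  apply: leq_trans (card_fiber A Am); rewrite sum1dep_card.
  by apply: subset_leq_card; apply/fintype.subsetP => k; rewrite !inE.
by rewrite sum_nat_const card_draws card_ord.
Qed.

End RefinementKeys.

(** * Binomial estimates for the prior *)

Section Binomials.
Local Open Scope nat_scope.

Lemma bin_leq_exp2 n m : 'C(n, m) <= 2 ^ n.
Proof.
elim: n m => [|n IH] [|m]; rewrite ?bin0 ?expn_gt0 ?bin0n//.
by rewrite binS expnS mul2n -addnn leq_add.
Qed.

(** If [N <= 2 * m], the crude bound [2 ^ (2 * N)] is at most [16 ^ m]. Otherwise each factor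
    [2 * N - i] of the falling factorial is at most [4 * (N - i)]. *)
Lemma bin_leq_bin_half n N m : n <= 2 * N -> m <= N -> 'C(n, m) <= 16 ^ m * 'C(N, m).
Proof.
move=> nN mN; apply: (@leq_trans 'C(2 * N, m)); first exact: leq_bin2l.
have [mN2|mN2] := leqP N (2 * m).
  apply: leq_trans (bin_leq_exp2 _ _) _; rewrite -[2 ^ _]muln1 leq_mul ?bin_gt0//.
  by rewrite -[16]/(2 ^ 4) -expnM leq_exp2l// -[4]/(2 * 2) -mulnA leq_mul2l.
suff h k : k <= m -> (2 * N) ^_ k <= 4 ^ k * N ^_ k.
  rewrite -(leq_pmul2r (fact_gt0 m)) -mulnA !bin_ffact.
  apply: leq_trans (h m (leqnn m)) _; rewrite leq_mul//.
  by rewrite (@leq_trans (4 ^ m * 4 ^ m)) ?leq_pmulr ?expn_gt0// -expnMn.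
elim: k => // k IH km; rewrite !ffactnSr expnS mulnACA [4 * _]mulnC.
rewrite mulnAC mulnA [X in _ <= X]mulnC.
have := IH (ltnW km); nia.
Qed.

Lemma bin_leq_exp k m : 'C(k + m, m) <= k.+1 ^ m.
Proof.
elim: m => [|m IH]; first by rewrite bin0.
rewrite -(leq_pmul2l (ltn0Sn m)) addnS -mul_bin_diag /=.
rewrite expnS mulnA leq_mul//; nia.
Qed.

(** Both sides count the pairs of disjoint sets of sizes [k] and [m] among [N] elements. *)
Lemma bin_prod N k m : k + m <= N ->
  'C(N, k) * 'C(N - k, m) = 'C(N, k + m) * 'C(k + m, m).
Proof.
move=> kmN; have kN : k <= N by lia. have mNk : m <= N - k by lia.
apply/eqP; rewrite -(eqn_pmul2r (fact_gt0 k)) -(eqn_pmul2r (fact_gt0 m)).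
rewrite -(eqn_pmul2r (fact_gt0 (N - k - m))); apply/eqP.
have := bin_fact kN; have := bin_fact mNk; have := bin_fact kmN.
have := @bin_fact (k + m) m (leq_addl _ _); rewrite addnK subnDA.
nia.
Qed.

(* The number of sets of [m] new cuts, against the ratio of the priors of a
   configuration with [k.+1] blocks and of one with [k.+1 + m] blocks. *)
Lemma bin_prior_bound n k m : 2 * k.+1 <= n -> k.+1 + m <= n ->
  'C(n, m) * 'C(n.-1, k) <= (16 * k.+1) ^ m * 'C(n.-1, k + m).
Proof.
move=> kn kmn; rewrite expnMn.
have h1 : 'C(n, m) <= 16 ^ m * 'C(n.-1 - k, m) by apply: bin_leq_bin_half; lia.
apply: leq_trans (leq_mul h1 (leqnn _)) _.
rewrite -!mulnA leq_mul// mulnC bin_prod; last by lia.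
by rewrite mulnC leq_mul// bin_leq_exp.
Qed.

End Binomials.

(** * Posterior of the refinements *)

Section PosteriorBound.
Context {R : realType} (K n : nat) (sigma lambda v alpha : R).
Context (Z : 'M[R]_(n.+1, K.+1)) (theta : 'cV[R]_n.+1).
Local Notation config := {set {set 'I_n.+1}}.
Implicit Types (B D E : config) (Y : 'cV[R]_n.+1).

(** The monomial columns lie in the column space of [Z], and the coefficients of the polynomial on
    [C] combine them. *)
Lemma piecewise_poly_fit B C : poly_basis Z -> piecewise_poly K theta B ->
  C \in B -> exists W, block_id C *m theta = block_id C *m Z *m W.
Proof.
move=> /andP[_ /andP[_ /submxP[M VM]]] pB /pB[p sp pfit].
exists (M^T *m \col_k p`_k); rewrite -mulmxA (mulmxA Z).
rewrite -[Z]trmxK -trmx_mul -VM trmxK; apply/matrixP => i j.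
rewrite !block_idE ord1; case: (boolP (i \in C)) => // iC; rewrite !mulr1n pfit//.
rewrite (horner_coef_wide _ sp) mxE; apply: eq_bigr => k _.
by rewrite !mxE mulrC.
Qed.

Lemma simple_partition_card_gt0 B : simple_partition B -> (0 < #|B|)%N.
Proof.
move=> /andP[/and3P[/eqP cB _ _] _]; rewrite card_gt0; apply/eqP => B0.
have : ord0 \in finset.cover B by rewrite cB inE.
by rewrite B0 => /finset.bigcupP[C]; rewrite inE.
Qed.

Lemma simple_partition_card_le B : simple_partition B -> (#|B| <= n.+1)%N.
Proof.
move=> sB; rewrite -(card_starts (simple_partition_family sB)).
by rewrite -[n.+1 in leqRHS](card_ord n.+1) max_card.
Qed.

Lemma posterior_weight_ge0 Y B : 0 <= posterior_weight sigma lambda v alpha Z Y B.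
Proof.
rewrite /posterior_weight !mulr_ge0 ?expR_ge0 ?powR_ge0// ?invr_ge0//.
by rewrite sumr_ge0// => i _; exact: powR_ge0.
Qed.

Definition prior_ratio (k m : nat) : R :=
  'C(n, k)%:R / 'C(n, k + m)%:R * ((n.+1%:R `^ lambda)^-1) ^+ m.

Lemma prior_ratio_ge0 k m : 0 <= prior_ratio k m.
Proof. by rewrite /prior_ratio mulr_ge0 ?divr_ge0 ?exprn_ge0 ?invr_ge0 ?powR_ge0. Qed.

Lemma priorE B B' k m : (k <= n)%N -> #|B| = k.+1 -> #|B'| = (k.+1 + m)%N ->
  prior lambda B' = prior lambda B * prior_ratio k m.
Proof.
move=> kn Bk B'm; rewrite /prior /block_count_pmf /prior_ratio Bk B'm /=.
have powE : n.+1%:R `^ (- lambda * (k + m)%:R) =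
    n.+1%:R `^ (- lambda * k%:R) * ((n.+1%:R `^ lambda)^-1) ^+ m :> R.
  rewrite natrD mulrDr powRD ?pnatr_eq0 ?implybT//; congr (_ * _).
  by rewrite powRrM powRN powR_mulrn// invr_ge0 powR_ge0.
rewrite powE; have Ck : 'C(n, k)%:R != 0 :> R by rewrite pnatr_eq0 -lt0n bin_gt0.
set S := \sum_(_ <= _ < _) _; set p := _ `^ _; set q := _ ^+ m.
set c := 'C(n, k)%:R; set c' := 'C(n, k + m)%:R.
transitivity (c^-1 * c * c'^-1 * (p * q / S)); first by rewrite mulVf// mul1r.
by ring.
Qed.

(** The likelihood part of the weight ratio; the blocks shared by both configurations cancel. *)
Definition key_factor Y (D E : config) : R :=
  expR (alpha / (2 * sigma ^+ 2) * (rss Z Y D - rss Z Y E)).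

(** An inequality only because of the dimension penalty: its base is at least [1] and its exponent
    decreases with the number of blocks, so the penalty of [B] is bounded by that of [B0]. *)
Lemma posterior_weight_refinement Y B0 B k :
  0 < sigma -> 0 < v -> 0 < alpha ->
  simple_partition B0 -> simple_partition B -> strict_refinement B B0 ->
  #|B0| = k.+1 ->
  posterior_weight sigma lambda v alpha Z Y B <=
  posterior_weight sigma lambda v alpha Z Y B0 *
    (prior_ratio k #|new_starts (B0 :\: B) (B :\: B0)| *
     key_factor Y (B0 :\: B) (B :\: B0)).
Proof.
move=> s0 v0 a0 sB0 sB BB0 B0k.
set m := #|_|; have Bm : #|B| = (k.+1 + m)%N by rewrite -B0k (card_new_starts sB0 sB).
have kn : (k <= n)%N by rewrite -ltnS -B0k simple_partition_card_le.
rewrite /posterior_weight (priorE kn B0k Bm) /key_factor.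
set D := B0 :\: B; set E := B :\: B0.
have rssB : rss Z Y B = rss Z Y (B :&: B0) + rss Z Y E by rewrite /rss -big_setID.
have rssB0 : rss Z Y B0 = rss Z Y (B :&: B0) + rss Z Y D.
  by rewrite /rss finset.setIC -big_setID.
set c := alpha / _.
have -> : expR (- c * rss Z Y B) =
    expR (- c * rss Z Y B0) * expR (c * (rss Z Y D - rss Z Y E)).
  by rewrite -expRD rssB rssB0; congr expR; ring.
set p := prior _ _; set r := prior_ratio _ _; set w := _ `^ _; set w0 := _ `^ _.
set e0 := expR _; set e := expR _.
have ww0 : w <= w0.
  apply: ler_powR.
    by rewrite lerDl divr_ge0 ?sqr_ge0// mulr_ge0// ltW.
  by rewrite ler_pM2r ?invr_gt0// lerN2 ler_nat leq_mul2l Bm B0k leq_addr orbT.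
have p0 : 0 <= p.
  rewrite /p /prior mulr_ge0 ?invr_ge0// divr_ge0 ?powR_ge0//.
  by rewrite sumr_ge0// => i _; exact: powR_ge0.
have -> : p * r * w * (e0 * e) = p * r * e0 * e * w by ring.
have -> : p * w0 * e0 * (r * e) = p * r * e0 * e * w0 by ring.
have r0 : 0 <= r by exact: prior_ratio_ge0.
have [e00 e_ge0] : 0 <= e0 /\ 0 <= e by split; exact: expR_ge0.
by rewrite ler_wpM2l//; exact: mulr_ge0 (mulr_ge0 (mulr_ge0 p0 r0) e00) e_ge0.
Qed.

Lemma posterior_refinement_le Y k :
  0 < sigma -> 0 < v -> 0 < alpha ->
  (forall B0, most_economical K theta B0 -> #|B0| = k.+1) ->
  posterior sigma lambda v alpha Z Y
    (fun B => exists2 B', most_economical K theta B' & strict_refinement B B') <=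
  \sum_(key | `[< refinement_key K theta key >])
     prior_ratio k #|new_starts key.1 key.2| * key_factor Y key.1 key.2.
Proof.
move=> s0 v0 a0 card_me; rewrite /posterior; set T := (X in _ <= X).
set w := posterior_weight _ _ _ _ _ _; set W := \sum_(B | simple_partition B) w B.
have w0 B : 0 <= w B by exact: posterior_weight_ge0.
pose g (key : config * config) :=
  prior_ratio k #|new_starts key.1 key.2| * key_factor Y key.1 key.2.
have g0 key : 0 <= g key by rewrite mulr_ge0 ?prior_ratio_ge0 ?expR_ge0.
have T0 : 0 <= T by apply: sumr_ge0 => key _; exact: g0.
have W0 : 0 <= W by exact: sumr_ge0.
(* Division by zero has value zero, which settles a vanishing normaliser. *)
have [->|Wn0] := eqVneq W 0; first by rewrite invr0 mulr0.
rewrite ler_pdivrMr; last by rewrite lt_neqAle eq_sym Wn0.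
pose me B := `[< most_economical K theta B >].
(* Each [B] is counted once for every economical configuration that it refines; overcounting is
   harmless since weights are nonnegative. *)
apply: (@le_trans _ _ (\sum_(B | simple_partition B)
    \sum_(B0 | me B0 && strict_refinement B B0) w B)).
  rewrite big_mkcondr; apply: ler_sum => B sB; case: ifPn => [|_]; last exact: sumr_ge0.
  move=> /asboolP[B0 eB0 BB0]; rewrite (bigD1 B0)/=; last by rewrite BB0 /me asboolT.
  by rewrite lerDl sumr_ge0.
rewrite (exchange_big_dep me) /=; last by move=> ? ? _ /andP[].
apply: (@le_trans _ _ (\sum_(B0 | me B0) w B0 * T)); last first.
  rewrite -mulr_suml mulrC ler_wpM2l// /W [leRHS](bigID me) /=.
  have -> : \sum_(B0 | me B0) w B0 = \sum_(B0 | simple_partition B0 && me B0) w B0.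
    apply: eq_bigl => B0; apply/idP/andP => [eB0|[]//]; split=> //.
    by case/asboolP: eB0.
  by rewrite lerDl sumr_ge0.
apply: ler_sum => B0 /asboolP eB0; have [sB0 _ _] := eB0.
pose key B := (B0 :\: B, B :\: B0).
apply: (@le_trans _ _ (\sum_(B | simple_partition B && (me B0 && strict_refinement B B0))
    w B0 * g (key B))).
  apply: ler_sum => B /and3P[sB _ BB0].
  exact: (posterior_weight_refinement _ s0 v0 a0 sB0 sB BB0 (card_me _ eB0)).
rewrite -mulr_sumr ler_wpM2l//.
(* Given [B0], the configuration [B] is [B0] without the removed blocks and with the added ones. *)
have key_inj : {in [pred B | simple_partition B && (me B0 && strict_refinement B B0)] &,
    injective key}.
  move=> B B' _ _ [DE EE]; apply/setP => C.
  have := congr1 (fun A : config => C \in A) DE.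
  have := congr1 (fun A : config => C \in A) EE; rewrite !inE.
  by case: (C \in B0); case: (C \in B); case: (C \in B').
rewrite -(big_imset g key_inj) /T big_mkcond [leRHS]big_mkcond /=.
apply: ler_sum => k' _; case: ifPn => [/imsetP[B PB k'E]|_]; last first.
  by case: ifP => // _; exact: g0.
rewrite ifT//; apply/asboolP; exists B0, B; split=> //.
- by case/andP: PB.
- by case/and3P: PB.
Qed.

Lemma measurable_rss B :
  measurable_fun [set: n.+1.-tuple R]%classic
    (fun y : n.+1.-tuple R => rss Z (\col_i tnth y i) B).
Proof.
under eq_fun do rewrite /rss big_mkcond.
apply: measurable_sum => C; case: (C \in B) => //.
apply: measurable_sum => i; apply: measurable_funX.
rewrite [X in measurable_fun _ X](_ : _ = fun y : n.+1.-tuple R =>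
    \sum_j (1%:M - orthoproj (block_rows C Z)) i j * tnth y (enum_val j)).
  apply: measurable_sum => j; apply: measurable_funM => //.
  exact: measurable_tnth.
by apply/funext => y; rewrite mxE; apply: eq_bigr => j _; rewrite !mxE.
Qed.

Lemma measurable_posterior (A : config -> Prop) :
  measurable_fun [set: n.+1.-tuple R]%classic
    (fun y : n.+1.-tuple R =>
       posterior sigma lambda v alpha Z (\col_i tnth y i) A).
Proof.
have mw B : measurable_fun [set: n.+1.-tuple R]%classic
    (fun y : n.+1.-tuple R =>
      posterior_weight sigma lambda v alpha Z (\col_i tnth y i) B).
  apply: measurable_funM => //; apply: measurableT_comp => //.
  by apply: measurable_funM => //; exact: measurable_rss.
have msum (P : pred config) : measurable_fun [set: n.+1.-tuple R]%classic
    (fun y : n.+1.-tuple R =>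
      \sum_(B | P B) posterior_weight sigma lambda v alpha Z (\col_i tnth y i) B).
  under eq_fun do rewrite big_mkcond.
  by apply: measurable_sum => B; case: (P B).
apply: measurable_funM; first exact: msum.
(* The normaliser is nonnegative, so its inverse is its power with exponent [-1], a measurable
   function. *)
rewrite [X in measurable_fun _ X](_ : _ = fun y : n.+1.-tuple R =>
    (\sum_(B | simple_partition B)
       posterior_weight sigma lambda v alpha Z (\col_i tnth y i) B) `^ (-1)).
  apply: (@measurableT_comp _ _ _ _ _ _ (fun x : R => x `^ (-1))); last exact: msum.
  exact: measurable_powR.
apply/funext => y; rewrite powR_inv1// sumr_ge0// => B _.
exact: posterior_weight_ge0.
Qed.

End PosteriorBound.

(** * Expectation of the bound and summation over the pairs *)

Section ExpectedPosterior.
Context {R : realType} (K n : nat) (sigma lambda v alpha : R).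
Context (Z : 'M[R]_(n.+1, K.+1)) (theta : 'cV[R]_n.+1).
Local Notation config := {set {set 'I_n.+1}}.
Local Notation Y_ y := (\col_i tnth y i).

Context (sigma_gt0 : 0 < sigma) (v_gt0 : 0 < v).
Context (alpha_gt0 : 0 < alpha) (alpha_lt1 : alpha < 1).
Context (Z_basis : poly_basis Z).

(** The price of one new cut: [K.+1] degrees of freedom, each with the moment from
    [gaussian_sqr_mgf]. *)
Let q : R := (Num.sqrt (1 - alpha))^-1 ^+ K.+1.

Lemma integral_key_factor (key : config * config) :
  refinement_key K theta key ->
  (\int[gaussian sigma theta]_y (key_factor sigma alpha Z (Y_ y) key.1 key.2)%:E <=
   (q ^+ #|new_starts key.1 key.2|)%:E)%E.
Proof.
move=> [B0 [B [[sB0 pB0 _] sB BB0 ->]]] /=.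
have /and3P[tD _ _] := removed_blocks_family B sB0.
rewrite /q -exprM -(card_nonfirst_blocks B0 sB).
apply: gaussian_rss_mgf => //.
- by rewrite ltW.
- exact: strict_refinement_refines.
- by apply/fintype.subsetP => X; rewrite inE => /andP[].
- exact: nonfirst_blocks_complement.
- move=> C; rewrite inE => /andP[_ CB0].
  exact: piecewise_poly_fit pB0 CB0.
Qed.

Lemma refinement_key_card (k : nat) (key : config * config) :
  (forall B0, most_economical K theta B0 -> #|B0| = k.+1) ->
  refinement_key K theta key ->
  (0 < #|new_starts key.1 key.2|)%N /\
  (k.+1 + #|new_starts key.1 key.2| <= n.+1)%N.
Proof.
move=> card_me [B0 [B [eB0 sB BB0 ->]]] /=; have [sB0 _ _] := eB0.
rewrite (new_starts_gt0 sB0 sB BB0); split=> //.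
by rewrite -(card_me _ eB0) -(card_new_starts sB0 sB BB0) simple_partition_card_le.
Qed.

(** The bound of [posterior_refinement_le] holds for every [Y] and is a finite nonnegative sum, so
    it is integrated term by term. *)
Lemma expected_posterior_le_keys (k : nat) :
  (forall B0, most_economical K theta B0 -> #|B0| = k.+1) ->
  ('E_(gaussian sigma theta)[fun y : n.+1.-tuple R =>
     posterior sigma lambda v alpha Z (Y_ y)
       (fun B => exists2 B', most_economical K theta B' & strict_refinement B B')]
   <= (\sum_(key | `[< refinement_key K theta key >])
         prior_ratio n lambda k #|new_starts key.1 key.2| *
         q ^+ #|new_starts key.1 key.2|)%:E)%E.
Proof.
move=> card_me; rewrite unlock.
pose s := [seq key <- index_enum (config * config)%type |
             `[< refinement_key K theta key >]].
pose g (key : config * config) (y : n.+1.-tuple R) :=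
  prior_ratio n lambda k #|new_starts key.1 key.2| *
  key_factor sigma alpha Z (Y_ y) key.1 key.2.
have g0 key y : 0 <= g key y by rewrite mulr_ge0 ?prior_ratio_ge0 ?expR_ge0.
have mkey (key : config * config) : measurable_fun [set: n.+1.-tuple R]%classic
    (fun y => key_factor sigma alpha Z (Y_ y) key.1 key.2).
  apply: measurableT_comp => //; apply: measurable_funM => //.
  by apply: measurable_funB; exact: measurable_rss.
have mg key : measurable_fun [set: n.+1.-tuple R]%classic (g key).
  exact: measurable_funM.
apply: (@le_trans _ _ (\int[gaussian sigma theta]_y (\sum_(key <- s) (g key y)%:E)%E)%E).
  apply: ge0_le_integral => //.
  - move=> y _; rewrite lee_fin /posterior divr_ge0// sumr_ge0// => B _;
      exact: posterior_weight_ge0.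
  - by apply/measurable_EFinP; exact: measurable_posterior.
  - under eq_fun do rewrite sumEFin.
    by apply/measurable_EFinP; exact: measurable_sum.
  - move=> y _; rewrite sumEFin lee_fin big_filter.
    exact: posterior_refinement_le.
rewrite ge0_integral_sum//; last 2 first.
- by move=> key; apply/measurable_EFinP.
- by move=> key y _; rewrite lee_fin.
rewrite -[X in (_ <= X%:E)%E]big_filter -/s -sumEFin big_seq [leRHS]big_seq.
apply: lee_sum => key; rewrite mem_filter => /andP[/asboolP vkey _].
under eq_integral do rewrite EFinM.
rewrite ge0_integralZl//; last 3 first.
- exact/measurable_EFinP.
- by move=> y _; rewrite lee_fin expR_ge0.
- by rewrite lee_fin prior_ratio_ge0.
by rewrite [leRHS]EFinM lee_wpmul2l ?lee_fin ?prior_ratio_ge0// integral_key_factor.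
Qed.

(** Pairs are grouped by their number of new cuts; in each group [bin_prior_bound] absorbs the
    number of pairs and the ratio of the binomial coefficients into a power. *)
Lemma refinement_keys_sum_le (k : nat) :
  (forall B0, most_economical K theta B0 -> #|B0| = k.+1) ->
  (2 * k.+1 <= n.+1)%N ->
  \sum_(key | `[< refinement_key K theta key >])
     prior_ratio n lambda k #|new_starts key.1 key.2| *
     q ^+ #|new_starts key.1 key.2| <=
  \sum_(m < n.+1)
     ((16 * k.+1 * (2 * K.+1 ^ 2))%:R * q / n.+1%:R `^ lambda) ^+ m.+1.
Proof.
move=> card_me kn; set x := _ / n.+1%:R `^ lambda.
have q0 : 0 <= q by rewrite exprn_ge0// invr_ge0 sqrtr_ge0.
have x0 : 0 <= x by rewrite divr_ge0 ?powR_ge0// mulr_ge0.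
pose F (m : nat) := prior_ratio n lambda k m * q ^+ m.
have card_lt (key : config * config) : (#|new_starts key.1 key.2| < n.+2)%N.
  by rewrite ltnS -[n.+1 in leqRHS](card_ord n.+1) max_card.
rewrite (partition_big (fun key => Ordinal (card_lt key)) xpredT)//= big_ord_recl.
rewrite big_pred0 ?add0r => [|key]; last first.
  apply/negbTE/negP => /andP[/asboolP/(refinement_key_card card_me)[m0 _]].
  by rewrite -val_eqE /= => /eqP m00; rewrite m00 in m0.
apply: ler_sum => m _; rewrite (eq_bigr (fun=> F m.+1)) => [|key]; last first.
  by move=> /andP[_ /eqP/(congr1 val)/= ->].
rewrite (eq_bigl (fun key => key \in refinement_keys K theta m.+1)); last first.
  move=> key; rewrite inE; congr (_ && _).
rewrite sumr_const; set S := refinement_keys _ _ _.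
(* An empty group contributes nothing; otherwise any of its members shows that [k.+1 + m.+1] is at
   most [n.+1], as [bin_prior_bound] requires. *)
have [-> |/set0Pn[key]] := eqVneq S finset.set0; first by rewrite cards0 mulr0n exprn_ge0.
move=> /refinement_keysP[/(refinement_key_card card_me)[_ kmn] key_m].
rewrite key_m in kmn.
have := bin_prior_bound kn kmn; have := card_refinement_keys K theta m.+1.
rewrite -/S; set L := (2 * K.+1 ^ 2)%N; set M := m.+1 => SL binle.
have c'0 : 0 < 'C(n, k + M)%:R :> R by rewrite ltr0n bin_gt0 -ltnS -addSn.
have key_bound : (#|S| * 'C(n, k) <= (16 * k.+1 * L) ^ M * 'C(n, k + M))%N.
  apply: leq_trans (leq_mul SL (leqnn _)) _.
  by rewrite mulnAC expnMn [X in (_ <= X)%N]mulnAC leq_mul.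
have -> : F M *+ #|S| =
    (#|S| * 'C(n, k))%:R / 'C(n, k + M)%:R * (q / n.+1%:R `^ lambda) ^+ M.
  rewrite /F /prior_ratio -mulr_natl natrM exprMn exprVn; ring.
have -> : x ^+ M = ((16 * k.+1 * L) ^ M)%:R * (q / n.+1%:R `^ lambda) ^+ M.
  by rewrite natrX -exprMn mulrA.
rewrite ler_wpM2r ?exprn_ge0 ?divr_ge0 ?powR_ge0//.
by rewrite ler_pdivrMr// -natrM ler_nat.
Qed.

End ExpectedPosterior.

(** The geometric sum is at most [1 / (1 - x)], hence at most [2]. *)
Lemma sum_powers_le (R : realFieldType) (x : R) n : 0 <= x <= 2^-1 ->
  \sum_(m < n) x ^+ m.+1 <= 2 * x.
Proof.
move=> /andP[x0 x2].
have -> : \sum_(m < n) x ^+ m.+1 = x * \sum_(m < n) x ^+ m.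
  by rewrite mulr_sumr; apply: eq_bigr => m _; rewrite exprS.
rewrite [leRHS]mulrC ler_wpM2l//; have := subrX1 x n.
have := exprn_ge0 n x0; have : 0 <= \sum_(m < n) x ^+ m.
  by apply: sumr_ge0 => m _; exact: exprn_ge0.
nra.
Qed.

(** * Uniform convergence to zero *)

Local Open Scope classical_set_scope.

Theorem theorem4 (R : realType) (K : nat) (sigma lambda v alpha : R)
    (sigma_gt0 : 0 < sigma) (lambda_gt0 : 0 < lambda) (v_gt0 : 0 < v)
    (alpha_gt0 : 0 < alpha) (alpha_lt1 : alpha < 1)
    (Z : forall n : nat, 'M[R]_(n, K.+1))
    (Z_basis : forall n : nat, (K < n)%N -> poly_basis (Z n))
    (b c : nat -> R)
    (b_small : b n / n%:R @[n --> \oo] --> (0 : R))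
    (c_small : c n / n%:R `^ lambda @[n --> \oo] --> (0 : R)) :
  forall eps : R, 0 < eps ->
  \forall n \near \oo, forall theta : 'cV[R]_n,
    num_blocks_le K theta (b n) -> num_blocks_le K theta (c n) ->
    ('E_(gaussian sigma theta)[
       fun y : n.-tuple R =>
         posterior sigma lambda v alpha (Z n) (\col_i tnth y i)
           (fun B => exists2 B', most_economical K theta B'
                                 & strict_refinement B B')]
     <= eps%:E)%E.
Proof.
move=> eps eps0.
pose q : R := (Num.sqrt (1 - alpha))^-1 ^+ K.+1.
pose A : R := (16 * (2 * K.+1 ^ 2))%:R * q.
have A0 : 0 < A.
  by rewrite mulr_gt0// exprn_gt0// invr_gt0 sqrtr_gt0 subr_gt0.
(* The ratio [x] of the geometric series is [A] times the number of blocks over the power of [n].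
   The first bound gives [x < 1 / 2], so that the series is at most [2 * x], and the second makes
   this at most [eps]. *)
pose d := Num.min 2^-1 (eps / 2) / A.
have d0 : 0 < d by rewrite divr_gt0// lt_min invr_gt0 ltr0n divr_gt0.
near=> n.
(* Stated for a free [m], which can be split into zero and successor; [K < m] rules out zero. *)
suff bound : forall m, (K < m)%N -> b m / m%:R < 2^-1 ->
    c m / m%:R `^ lambda < d -> forall theta : 'cV[R]_m,
    num_blocks_le K theta (b m) -> num_blocks_le K theta (c m) ->
    ('E_(gaussian sigma theta)[
       fun y : m.-tuple R =>
         posterior sigma lambda v alpha (Z m) (\col_i tnth y i)
           (fun B => exists2 B', most_economical K theta B'
                                 & strict_refinement B B')]
     <= eps%:E)%E.
  apply: bound.
  - by near: n; exact: nbhs_infty_gt.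
  - apply: le_lt_trans (ler_norm _) _; near: n.
    by apply: cvgr0_norm_lt => //; rewrite invr_gt0.
  - by apply: le_lt_trans (ler_norm _) _; near: n; exact: cvgr0_norm_lt.
move=> [//|m] m0 bm cm theta nb nc.
have [B0 eB0 B0b] := nb; have [B0' eB0' B0c] := nc.
(* All economical configurations have the same size, so the bounds by [b] and by [c] concern one
   number [k.+1]. *)
have card_me B : most_economical K theta B -> #|B| = #|B0|.
  move=> [sB pB minB]; have [sB0 pB0 minB0] := eB0.
  by apply/eqP; rewrite eqn_leq minB//= minB0.
have [k B0k] : exists k, #|B0| = k.+1.
  have [sB0 _ _] := eB0; exists #|B0|.-1.
  by rewrite prednK// simple_partition_card_gt0.
rewrite card_me// B0k in B0c; rewrite B0k in B0b card_me.
(* Here the sparsity [b n = o(n)] enters: at most half as many blocks as indices, as the binomial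
   estimate demands. *)
have kn : (2 * k.+1 <= m.+1)%N.
  rewrite -(ler_nat R) natrM; move: bm; rewrite ltr_pdivrMr ?ltr0n// => bm.
  by have := le_lt_trans B0b bm; rewrite -[leRHS](mulfVK (_ : 2 != 0))//; lra.
pose x : R := (16 * k.+1 * (2 * K.+1 ^ 2))%:R * q / m.+1%:R `^ lambda.
have P0 : 0 < m.+1%:R `^ lambda :> R by rewrite powR_gt0.
have xE : x = A * (k.+1%:R / m.+1%:R `^ lambda).
  by rewrite /x /A !natrM; ring.
have xd : x < Num.min 2^-1 (eps / 2).
  rewrite xE mulrC -ltr_pdivlMr//; apply: le_lt_trans cm.
  by rewrite ler_pM2r ?invr_gt0.
have x0 : 0 <= x by rewrite xE mulr_ge0 ?divr_ge0// ltW.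
move: xd; rewrite lt_min => /andP[x2 xe].
apply: le_trans (expected_posterior_le_keys _ sigma_gt0 v_gt0 alpha_gt0
  alpha_lt1 (Z_basis _ m0) card_me) _.
rewrite lee_fin; apply: le_trans (refinement_keys_sum_le _ _ card_me kn) _.
apply: le_trans (sum_powers_le _ _) _; first by rewrite x0 ltW.
by rewrite mulrC -ler_pdivlMr// ltW.
Unshelve. all: by end_near. Qed.
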